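(* Let $G$ be a small groupoid with $G_0$ finite, let $F : G \rightarrow \mathrm{PIC}_{cat}$ be a partial functor of inverse categories (with fixed representing bimodules $P_g$, $g \in G_1$), put $A = \prod_{e \in G_0} A_e$ where $A_e = F(e)$, and let $f$ be a partial factor set associated with $F$. Then the map $H^2(G, U(Z(A))) \rightarrow C(A,F)$, sending the class $[q]$ of a $2$-cocycle $q$ to the class of $(F,qf)$, where $(qf)_{g,h}(x \otimes y) = q_{g,h} f_{g,h}(x \otimes y)$ for $(g,h) \in G_2$, $x \in P_g$, $y \in P_h$, is bijective.
   Context: **Conventions.** Rings are associative and unital; the zero ring is allowed, with identity $0$. $Z(\cdot)$ is the center, $U(\cdot)$ the unit group. A unital ideal $I$ of a ring $A$ is a two-sided ideal having a multiplicative identity $1_I$ (then $1_I$ is a central idempotent of $A$ and $I = 1_I A$). For a category $G$, $G_0$ and $G_1$ are the objects and morphisms, $d(g)$ and $c(g)$ the domain and codomain of $g$, and $G_n$ ($n\ge 2$) is the collection of $(g_1,\dots,g_n)$ with $d(g_i)=c(g_{i+1})$; the composite of $(g,h)\in G_2$ is $gh$. Objects are identified with their identity morphisms. An inverse category is a category in which for each $g\in G_1$ there is a unique $g^*$ with $(g,g^* ),(g^*,g)\in G_2$, $gg^*g=g$, $g^*gg^*=g^*$; in a groupoid $g^*=g^{-1}$. **Partial functor.** A partial functor of inverse categories $F:G\to H$ is a pair of maps $G_0\to H_0$, $G_1\to H_1$ (both written $F$) with: (I1) if $g:a\to b$ then $F(g):F(a)\to F(b)$; (I2) $F(\mathrm{id}_a)=\mathrm{id}_{F(a)}$;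 (I3) for $(g,h)\in G_2$, $F(g)F(h)=F(g)F(g^* )F(gh)=F(gh)F(h^* )F(h)$. **Equivalence data.** A set of equivalence data $(I,J,P,Q,\alpha,\beta)$ consists of rings $I,J$, an $I$-$J$-bimodule $P$, a $J$-$I$-bimodule $Q$, an $I$-bimodule isomorphism $\alpha:P\otimes_J Q\to I$ and a $J$-bimodule isomorphism $\beta:Q\otimes_I P\to J$ with $\alpha(p\otimes q)p'=p\beta(q\otimes p')$ and $\beta(q\otimes p)q'=q\alpha(p\otimes q')$ for all $p,p'\in P$, $q,q'\in Q$. In this case there is a unique ring isomorphism $\gamma_P:Z(J)\to Z(I)$ with $\gamma_P(b)p=pb$ for all $p\in P$, $b\in Z(J)$. A set of partial equivalence data $(A,B,I,J,P,Q,\alpha,\beta)$ consists of rings $A,B$, unital ideals $I$ of $A$ and $J$ of $B$, and a set of equivalence data $(I,J,P,Q,\alpha,\beta)$; $P$ is also regarded as an $A$-$B$-bimodule via $ap=(a1_I)p$, $pb=p(1_Jb)$, and similarly for $Q$. **The category $\mathrm{PIC}_{cat}$.** Given rings $A,B$, unital ideals $I$ of $A$ and $J$ of $B$, and an $I$-$J$-bimodule $P$ (regarded also as an $A$-$B$-bimodule via $ap=(a1_I)p$, $pb=p(1_Jb)$), write ${}_A^IP_B^J$ for $P$ together with these rings and ideals; it is partially invertible if it is part of a set of partial equivalence data. ${}_A^IP_B^J\sim{}_{A'}^{I'}{P'}_{B'}^{J'}$ iff $(A,B,I,J)=(A',B',I',J')$ and $P\cong P'$ as $I$-$J$-bimodules.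 Objects of $\mathrm{PIC}_{cat}$ are all rings; morphisms $B\to A$ are the classes $[{}_A^IP_B^J]$ of partially invertible bimodules; identities are $[{}_A^AA_A^A]$; composition is $[{}_A^IP_B^J][{}_B^{I'}{P'}_C^{J'}]=[{}_A^{I''}(P\otimes_BP')_C^{J''}]$ with $I''=\gamma_P(1_J1_{I'})A$, $J''=\gamma_{P'}^{-1}(1_J1_{I'})C$. This is an inverse category with $[{}_A^IP_B^J]^*=[{}_B^JQ_A^I]$. **Partial factor sets and crossed products.** Given $F:G\to\mathrm{PIC}_{cat}$, put $A_e=F(e)$ for $e\in G_0$ and, for each $g\in G_1$, fix a representative: $F(g)=[{}_{A_{c(g)}}^{I_g}(P_g)_{A_{d(g)}}^{I_{g^{-1}}}]$ (the right-hand ideal is $I_{g^{-1}}$ because $F(g^{-1})=F(g)^*$). Put $\epsilon_g=1_{I_g}$. For $(g,h)\in G_2$ one has $\epsilon_gP_{gh}=P_{gh}\epsilon_{h^{-1}}$. A partial factor set associated with $F$ is a family $f=\{f_{g,h}\mid (g,h)\in G_2\}$ of $A_{c(g)}$-$A_{d(h)}$-bimodule isomorphisms $f_{g,h}:P_g\otimes_{A_{d(g)}}P_h\to\epsilon_gP_{gh}=P_{gh}\epsilon_{h^{-1}}$ such that $f_{gh,r}\circ(f_{g,h}\otimes\mathrm{id}_{P_r})=f_{g,hr}\circ(\mathrm{id}_{P_g}\otimes f_{h,r})$ for all $(g,h,r)\in G_3$. Then $(F,f)$ is the $G$-graded ring $\oplus_{g\in G_1}P_g$ with multiplication the biadditive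 extension of $x\cdot y=f_{g,h}(x\otimes y)$ for $x\in P_g,y\in P_h$ if $(g,h)\in G_2$, and $x\cdot y=0$ otherwise. **$C(A,F)$.** For partial factor sets $f,f'$ associated with $F$, $(F,f)\approx(F,f')$ iff there is a ring isomorphism $(F,f)\to(F,f')$ restricting for each $g\in G_1$ to an $A_{c(g)}$-$A_{d(g)}$-bimodule isomorphism $P_g\to P_g$. $C(A,F)$ is the collection of $\approx$-classes of all $(F,f)$, where $f$ runs over all partial factor sets associated with $F$. **Cohomology.** Put $B_e=Z(A_e)$, $B=\prod_{e\in G_0}B_e$, $B_g=Z(I_g)$ (a unital ideal of $B_{c(g)}$ with identity $1_g=\epsilon_g$) and $\theta_g=\gamma_{P_g}:B_{g^{-1}}\to B_g$. $C^1(G,B)$ is the group (pointwise multiplication) of functions $c$ on $G_1$ with $c_g$ invertible in $B_g$; for $n\geq 2$, $C^n(G,B)$ is the group of functions $q$ on $G_n$ with $q(g_1,\dots,g_n)$ invertible in $B_{g_1}B_{g_1g_2}\cdots B_{g_1\cdots g_n}$. All inverses are taken in the corresponding ideals. For $n \ge 1$, $\delta^n:C^n(G,B)\to C^{n+1}(G,B)$ is $$\delta^n(q)(g_1,\dots,g_{n+1})=\theta_{g_1}(1_{g_1^{-1}}q(g_2,\dots,g_{n+1}))\Big(\prod_{i=1}^nq(g_1,\dots,g_ig_{i+1},\dots,g_{n+1})^{(-1)^i}\Big)q(g_1,\dots,g_n)^{(-1)^{n+1}}.$$ $H^2(G,U(Z(A)))$ denotes $H^2(G,B)=\ker\delta^2/\mathrm{im}\,\delta^1$;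 write $q_{g,h}=q(g,h)$. *)

(* Defs.v *)
From HB Require Import structures.
From mathcomp Require Import all_boot all_algebra.
From mathcomp Require Import generic_quotient ring_quotient.
From mathcomp Require Import finmap freeg.
From mathcomp Require Import boolp classical_sets functions cardinality fsbigop.

Set Implicit Arguments.
Unset Strict Implicit.
Unset Printing Implicit Defensive.

Import GRing.Theory.
Local Open Scope classical_set_scope.
Local Open Scope ring_scope.

Record bimod (R S : pzRingType) := Bimod {
  bmcar :> zmodType;
  lact : R -> bmcar -> bmcar;
  ract : bmcar -> S -> bmcar;
  lactDl : forall a b m, lact (a + b) m = lact a m + lact b m;
  lactDr : forall a m n, lact a (m + n) = lact a m + lact a n;
  lactA : forall a b m, lact (a * b) m = lact a (lact b m);
  lact1 : forall m, lact 1 m = m;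
  ractDl : forall m n b, ract (m + n) b = ract m b + ract n b;
  ractDr : forall m a b, ract m (a + b) = ract m a + ract m b;
  ractA : forall m a b, ract m (a * b) = ract (ract m a) b;
  ract1 : forall m, ract m 1 = m;
  lractA : forall a m b, lact a (ract m b) = ract (lact a m) b
}.

Notation "a *l m" := (lact a m) (at level 40, left associativity).
Notation "m *r b" := (ract m b) (at level 40, left associativity).

Section BimodMaps.
Variables R S : pzRingType.

Definition regular (A : pzRingType) : bimod A A :=
  @Bimod A A A *%R *%R (@mulrDl A) (@mulrDr A) (fun a b m => esym (mulrA a b m))
    (@mul1r A) (@mulrDl A) (@mulrDr A) (@mulrA A) (@mulr1 A) (@mulrA A).

Definition additive_map (V W : zmodType) (phi : V -> W) : Prop :=
  forall x y, phi (x + y) = phi x + phi y.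

Definition bimod_hom (M N : bimod R S) (phi : M -> N) : Prop :=
  [/\ additive_map phi,
      forall a m, phi (a *l m) = a *l phi m
    & forall m b, phi (m *r b) = phi m *r b].

Definition bimod_iso (M N : bimod R S) (phi : M -> N) : Prop :=
  bimod_hom phi /\ bijective phi.

(* When X and Y are unital ideals of R and S whose identities act as the identity
   of M and N, this is isomorphism as X-Y-bimodules. *)
Definition isomorphic_over (X : {pred R}) (Y : {pred S}) (M N : bimod R S) :=
  exists phi : M -> N,
    [/\ additive_map phi,
        forall a m, a \in X -> phi (a *l m) = a *l phi m,
        forall m b, b \in Y -> phi (m *r b) = phi m *r b
      & bijective phi].
End BimodMaps.

Section Tensor.
Variables (R S T : pzRingType) (M : bimod R S) (N : bimod S T).

Definition free_pair (m : M) (n : N) : {freeg (M * N)} := << (m, n) >>.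

Inductive tensor_relator : {freeg (M * N)} -> Prop :=
| RelDl m m' n :
    tensor_relator (free_pair (m + m') n - free_pair m n - free_pair m' n)
| RelDr m n n' :
    tensor_relator (free_pair m (n + n') - free_pair m n - free_pair m n')
| RelBal m s n :
    tensor_relator (free_pair (m *r s) n - free_pair m (s *l n)).

(* The subgroup generated by the relators; M ⊗ N is the quotient by it. *)
Definition tensor_null : {pred {freeg (M * N)}} := fun x =>
  `[< forall X : set {freeg (M * N)}, X 0 ->
        (forall u v, X u -> X v -> X (u - v)) ->
        tensor_relator `<=` X -> X x >].

Lemma tensor_null_zmod_closed : zmod_closed tensor_null.
Proof.
split; first by rewrite unfold_in; apply/asboolP => X X0 _ _.
move=> u v; rewrite !unfold_in => /asboolP hu /asboolP hv.
by apply/asboolP => X X0 XB XR; apply: (XB); [exact: hu | exact: hv].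
Qed.

HB.instance Definition _ :=
  GRing.isZmodClosed.Build {freeg (M * N)} tensor_null tensor_null_zmod_closed.

Definition tensor_car : zmodType := Quotient.quot tensor_null.

Local Notation proj := (\pi_(Quotient.quot tensor_null)%qT).

Definition pure (m : M) (n : N) : tensor_car := proj (free_pair m n).

Lemma relator_null x : tensor_relator x -> proj x = 0 :> tensor_car.
Proof.
move=> hx; have -> : (0 : tensor_car) = proj 0 by rewrite raddf0.
apply/eqP; rewrite -Quotient.idealrBE subr0 unfold_in.
by apply/asboolP => X _ _; apply.
Qed.

Lemma pureDl m m' n : pure (m + m') n = pure m n + pure m' n.
Proof.
have /eqP := relator_null (RelDl m m' n); rewrite !raddfB /=.
by rewrite subr_eq0 subr_eq [X in _ == X]addrC => /eqP.
Qed.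

Lemma pureDr m n n' : pure m (n + n') = pure m n + pure m n'.
Proof.
have /eqP := relator_null (RelDr m n n'); rewrite !raddfB /=.
by rewrite subr_eq0 subr_eq [X in _ == X]addrC => /eqP.
Qed.

Lemma pure_bal m s n : pure (m *r s) n = pure m (s *l n).
Proof.
have /eqP := relator_null (RelBal m s n).
by rewrite !raddfB subr_eq0 => /eqP.
Qed.

Lemma tensor_ind (Q : tensor_car -> Prop) :
    (forall m n, Q (pure m n)) -> Q 0 ->
    (forall x y, Q x -> Q y -> Q (x - y)) ->
  forall x, Q x.
Proof.
move=> Qp Q0 QB.
have QN x : Q x -> Q (- x) by rewrite -[- x]sub0r; apply: QB.
have QD x y : Q x -> Q y -> Q (x + y).
  by move=> Qx Qy; rewrite -[y]opprK; apply: QB => //; apply: QN.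
have QMn x n : Q x -> Q (x *+ n).
  by move=> Qx; elim: n => [|n IHn]; rewrite ?mulr0n // mulrS; apply: QD.
elim/quotW => D; elim/freeg_ind_dom0: D => [|k [m n] D _ _ IH].
  by rewrite raddf0.
rewrite raddfD; apply: QD IH.
have -> : << k *g (m, n) >> = free_pair m n *~ k :> {freeg (M * N)}.
  by rewrite freeg_mulz intz.
by rewrite raddfMz; case: k => k; rewrite ?NegzE ?mulrNz -pmulrn;
   [|apply: QN]; apply: QMn; apply: Qp.
Qed.

Section Lift.
Variables (V : zmodType) (b : M -> N -> V).
Hypothesis bDl : forall m m' n, b (m + m') n = b m n + b m' n.
Hypothesis bDr : forall m n n', b m (n + n') = b m n + b m n'.
Hypothesis b_bal : forall m s n, b (m *r s) n = b m (s *l n).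

Definition free_lift : {freeg (M * N)} -> zmodule V :=
  fglift (fun mn : M * N => b mn.1 mn.2 : zmodule V).

Lemma free_liftB u v : free_lift (u - v) = free_lift u - free_lift v.
Proof. exact: (lift_is_additive (fun mn : M * N => b mn.1 mn.2 : zmodule V)). Qed.

Lemma free_lift_pair m n : free_lift (free_pair m n) = b m n.
Proof. by rewrite /free_lift /free_pair liftU scale1r. Qed.

Definition tensor_lift (x : tensor_car) : V := free_lift (repr x).

Lemma tensor_lift_proj x : tensor_lift (proj x) = free_lift x.
Proof.
apply/eqP; rewrite /tensor_lift -subr_eq0 -free_liftB; apply/eqP.
have : repr (proj x) - x \in tensor_null.
  by rewrite Quotient.idealrBE reprK.
rewrite unfold_in => /asboolP /(_ [set u | free_lift u = 0]); apply => /= [|u v hu hv|_ [m m' n|m n n'|m s n]] /=.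
- by rewrite -[0](subrr (0 : {freeg (M * N)})) free_liftB subrr.
- by rewrite free_liftB hu hv subr0.
- by rewrite !free_liftB !free_lift_pair bDl -addrA -opprD subrr.
- by rewrite !free_liftB !free_lift_pair bDr -addrA -opprD subrr.
- by rewrite free_liftB !free_lift_pair b_bal subrr.
Qed.

Lemma tensor_lift_pure m n : tensor_lift (pure m n) = b m n.
Proof. by rewrite tensor_lift_proj free_lift_pair. Qed.

Lemma tensor_liftB x y : tensor_lift (x - y) = tensor_lift x - tensor_lift y.
Proof.
elim/quotW: x => x; elim/quotW: y => y.
by rewrite -raddfB !tensor_lift_proj free_liftB.
Qed.

Lemma tensor_lift0 : tensor_lift 0 = 0.
Proof. by rewrite -[0](subrr (0 : tensor_car)) tensor_liftB subrr. Qed.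

Lemma tensor_liftD x y : tensor_lift (x + y) = tensor_lift x + tensor_lift y.
Proof.
by rewrite -{1}[y]opprK tensor_liftB -[- y]sub0r tensor_liftB tensor_lift0
  sub0r opprK.
Qed.
End Lift.

Definition tensor_lact (a : R) : tensor_car -> tensor_car :=
  tensor_lift (fun m n => pure (a *l m) n).
Definition tensor_ract (x : tensor_car) (c : T) : tensor_car :=
  tensor_lift (fun m n => pure m (n *r c)) x.

Let lDl a m m' n : pure (a *l (m + m')) n = pure (a *l m) n + pure (a *l m') n.
Proof. by rewrite lactDr pureDl. Qed.
Let lDr a m n n' : pure (a *l m) (n + n') = pure (a *l m) n + pure (a *l m) n'.
Proof. exact: pureDr. Qed.
Let lbal a m s n : pure (a *l (m *r s)) n = pure (a *l m) (s *l n).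
Proof. by rewrite lractA pure_bal. Qed.
Let rDl c m m' n : pure (m + m') (n *r c) = pure m (n *r c) + pure m' (n *r c).
Proof. exact: pureDl. Qed.
Let rDr c m n n' : pure m ((n + n') *r c) = pure m (n *r c) + pure m (n' *r c).
Proof. by rewrite ractDl pureDr. Qed.
Let rbal c m s n : pure (m *r s) (n *r c) = pure m ((s *l n) *r c).
Proof. by rewrite pure_bal lractA. Qed.

Lemma tensor_lact_pure a m n : tensor_lact a (pure m n) = pure (a *l m) n.
Proof. exact: (tensor_lift_pure (lDl a) (lDr a) (lbal a)). Qed.
Lemma tensor_lactB a x y :
  tensor_lact a (x - y) = tensor_lact a x - tensor_lact a y.
Proof. exact: (tensor_liftB (lDl a) (lDr a) (lbal a)). Qed.
Lemma tensor_lactDr a x y :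
  tensor_lact a (x + y) = tensor_lact a x + tensor_lact a y.
Proof. exact: (tensor_liftD (lDl a) (lDr a) (lbal a)). Qed.
Lemma tensor_lact0 a : tensor_lact a 0 = 0.
Proof. exact: (tensor_lift0 (lDl a) (lDr a) (lbal a)). Qed.

Lemma tensor_ract_pure c m n : tensor_ract (pure m n) c = pure m (n *r c).
Proof. exact: (tensor_lift_pure (rDl c) (rDr c) (rbal c)). Qed.
Lemma tensor_ractB c x y :
  tensor_ract (x - y) c = tensor_ract x c - tensor_ract y c.
Proof. exact: (tensor_liftB (rDl c) (rDr c) (rbal c)). Qed.
Lemma tensor_ractDl x y c :
  tensor_ract (x + y) c = tensor_ract x c + tensor_ract y c.
Proof. exact: (tensor_liftD (rDl c) (rDr c) (rbal c)). Qed.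
Lemma tensor_ract0 c : tensor_ract 0 c = 0.
Proof. exact: (tensor_lift0 (rDl c) (rDr c) (rbal c)). Qed.

Lemma tensor_lactDl a b x :
  tensor_lact (a + b) x = tensor_lact a x + tensor_lact b x.
Proof.
elim/tensor_ind: x => [m n||x y hx hy].
- by rewrite !tensor_lact_pure lactDl pureDl.
- by rewrite !tensor_lact0 addr0.
- by rewrite !tensor_lactB hx hy opprD addrACA.
Qed.
Lemma tensor_lactA a b x :
  tensor_lact (a * b) x = tensor_lact a (tensor_lact b x).
Proof.
elim/tensor_ind: x => [m n||x y hx hy].
- by rewrite !tensor_lact_pure lactA.
- by rewrite !tensor_lact0.
- by rewrite !tensor_lactB hx hy.
Qed.
Lemma tensor_lact1 x : tensor_lact 1 x = x.
Proof.
elim/tensor_ind: x => [m n||x y hx hy].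
- by rewrite tensor_lact_pure lact1.
- by rewrite tensor_lact0.
- by rewrite tensor_lactB hx hy.
Qed.
Lemma tensor_ractDr x a b :
  tensor_ract x (a + b) = tensor_ract x a + tensor_ract x b.
Proof.
elim/tensor_ind: x => [m n||x y hx hy].
- by rewrite !tensor_ract_pure ractDr pureDr.
- by rewrite !tensor_ract0 addr0.
- by rewrite !tensor_ractB hx hy opprD addrACA.
Qed.
Lemma tensor_ractA x a b :
  tensor_ract x (a * b) = tensor_ract (tensor_ract x a) b.
Proof.
elim/tensor_ind: x => [m n||x y hx hy].
- by rewrite !tensor_ract_pure ractA.
- by rewrite !tensor_ract0.
- by rewrite !tensor_ractB hx hy.
Qed.
Lemma tensor_ract1 x : tensor_ract x 1 = x.
Proof.
elim/tensor_ind: x => [m n||x y hx hy].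
- by rewrite tensor_ract_pure ract1.
- by rewrite tensor_ract0.
- by rewrite tensor_ractB hx hy.
Qed.
Lemma tensor_lractA a x b :
  tensor_lact a (tensor_ract x b) = tensor_ract (tensor_lact a x) b.
Proof.
elim/tensor_ind: x => [m n||x y hx hy].
- by rewrite !(tensor_ract_pure, tensor_lact_pure).
- by rewrite !(tensor_lact0, tensor_ract0).
- by rewrite !(tensor_lactB, tensor_ractB) hx hy.
Qed.

Definition tensor : bimod R T :=
  Bimod tensor_lactDl tensor_lactDr tensor_lactA tensor_lact1
        tensor_ractDl tensor_ractDr tensor_ractA tensor_ract1 tensor_lractA.
End Tensor.

Arguments tensor {R S T} M N.
Notation "M ⊗ N" := (tensor M N) (at level 40, left associativity).
Notation "m ⊗t n" := (pure m n : tensor _ _) (at level 40, left associativity).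

Record unital_ideal (A : pzRingType) := UnitalIdeal {
  ui_pred :> {pred A};
  ui_one : A;
  ui_mem0 : 0 \in ui_pred;
  ui_memB : forall x y, x \in ui_pred -> y \in ui_pred -> x - y \in ui_pred;
  ui_memMl : forall a x, x \in ui_pred -> a * x \in ui_pred;
  ui_memMr : forall x a, x \in ui_pred -> x * a \in ui_pred;
  ui_mem1 : ui_one \in ui_pred;
  ui_mul1 : forall x, x \in ui_pred -> ui_one * x = x;
  ui_1mul : forall x, x \in ui_pred -> x * ui_one = x
}.

Section IdealRing.
Variables (A : pzRingType) (I : unital_ideal A).

Lemma ui_zmod_closed : zmod_closed I.
Proof. by split; [apply: ui_mem0 | move=> x y; apply: ui_memB]. Qed.

HB.instance Definition _ := GRing.isZmodClosed.Build A (ui_pred I) ui_zmod_closed.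

Record ideal_ring : predArgType :=
  IdealElt { ideal_val :> A; _ : ideal_val \in ui_pred I }.

HB.instance Definition _ := [isSub for ideal_val].
HB.instance Definition _ := [Choice of ideal_ring by <:].
HB.instance Definition _ := [SubChoice_isSubZmodule of ideal_ring by <:].

Lemma ideal_valP (x : ideal_ring) : ideal_val x \in I.
Proof. exact: valP x. Qed.

Definition ideal_one : ideal_ring := IdealElt (ui_mem1 I).
Definition ideal_mul (x y : ideal_ring) : ideal_ring :=
  IdealElt (ui_memMl (ideal_val x) (ideal_valP y)).

Lemma ideal_mulA : associative ideal_mul.
Proof. by move=> x y z; apply: val_inj; rewrite /= mulrA. Qed.
Lemma ideal_mul1 : left_id ideal_one ideal_mul.
Proof. by move=> x; apply: val_inj; rewrite /= ui_mul1 // ideal_valP. Qed.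
Lemma ideal_1mul : right_id ideal_one ideal_mul.
Proof. by move=> x; apply: val_inj; rewrite /= ui_1mul // ideal_valP. Qed.
Lemma ideal_mulDl : left_distributive ideal_mul +%R.
Proof. by move=> x y z; apply: val_inj; rewrite /= mulrDl. Qed.
Lemma ideal_mulDr : right_distributive ideal_mul +%R.
Proof. by move=> x y z; apply: val_inj; rewrite /= mulrDr. Qed.

HB.instance Definition _ := GRing.Zmodule_isPzRing.Build ideal_ring
  ideal_mulA ideal_mul1 ideal_1mul ideal_mulDl ideal_mulDr.

Definition to_ideal_l (a : A) : ideal_ring := IdealElt (ui_memMl a (ui_mem1 I)).
Definition to_ideal_r (a : A) : ideal_ring := IdealElt (ui_memMr a (ui_mem1 I)).

Lemma to_ideal_lD a b : to_ideal_l (a + b) = to_ideal_l a + to_ideal_l b.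
Proof. by apply: val_inj; rewrite /= mulrDl. Qed.
Lemma to_ideal_rD a b : to_ideal_r (a + b) = to_ideal_r a + to_ideal_r b.
Proof. by apply: val_inj; rewrite /= mulrDr. Qed.
Lemma to_ideal_lM a b : to_ideal_l (a * b) = to_ideal_l a * to_ideal_l b.
Proof.
apply: val_inj; rewrite /= -!mulrA ui_mul1 //.
by apply: ui_memMl; apply: ui_mem1.
Qed.
Lemma to_ideal_rM a b : to_ideal_r (a * b) = to_ideal_r a * to_ideal_r b.
Proof.
apply: val_inj; rewrite /= !mulrA ui_1mul //.
by apply: ui_memMr; apply: ui_mem1.
Qed.
Lemma to_ideal_l1 : to_ideal_l 1 = 1.
Proof. by apply: val_inj; rewrite /= mul1r. Qed.
Lemma to_ideal_r1 : to_ideal_r 1 = 1.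
Proof. by apply: val_inj; rewrite /= mulr1. Qed.

End IdealRing.

Definition full_ideal (A : pzRingType) : unital_ideal A :=
  @UnitalIdeal A predT 1 isT (fun _ _ _ _ => isT) (fun _ _ _ => isT)
    (fun _ _ _ => isT) isT (fun x _ => mul1r x) (fun x _ => mulr1 x).

Definition ideal_center (A : pzRingType) (I : unital_ideal A) : set A :=
  [set x | x \in I /\ forall y, y \in I -> x * y = y * x].

Section EquivalenceData.
Variables (I J : pzRingType) (P : bimod I J) (Q : bimod J I).

Record equivalence_data (alpha : P ⊗ Q -> regular I) (beta : Q ⊗ P -> regular J)
    : Prop := EquivalenceData {
  ed_alpha : bimod_iso alpha;
  ed_beta : bimod_iso beta;
  ed_PQP : forall p q p',
    (alpha (p ⊗t q) : I) *l p' = p *r (beta (q ⊗t p') : J);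
  ed_QPQ : forall q p q',
    (beta (q ⊗t p) : J) *l q' = q *r (alpha (p ⊗t q') : I)
}.
End EquivalenceData.

Record pbimod (A B : pzRingType) := PBimod {
  pb_l : unital_ideal A;
  pb_r : unital_ideal B;
  pb_bimod : bimod (ideal_ring pb_l) (ideal_ring pb_r)
}.

Definition partially_invertible (A B : pzRingType) (P : pbimod A B) : Prop :=
  exists (Q : bimod (ideal_ring (pb_r P)) (ideal_ring (pb_l P)))
         (alpha : pb_bimod P ⊗ Q -> regular (ideal_ring (pb_l P)))
         (beta : Q ⊗ pb_bimod P -> regular (ideal_ring (pb_r P))),
    equivalence_data alpha beta.

(* The A-B-bimodule given by a p = (a 1_I) p and p b = p (1_J b). *)
Section Extension.
Variables (A B : pzRingType) (P : pbimod A B).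
Local Notation M := (pb_bimod P).

Definition ext_lact (a : A) (p : M) : M := to_ideal_l (pb_l P) a *l p.
Definition ext_ract (p : M) (b : B) : M := p *r to_ideal_r (pb_r P) b.

Lemma ext_lactDl a b m : ext_lact (a + b) m = ext_lact a m + ext_lact b m.
Proof. by rewrite /ext_lact to_ideal_lD lactDl. Qed.
Lemma ext_lactDr a m n : ext_lact a (m + n) = ext_lact a m + ext_lact a n.
Proof. exact: lactDr. Qed.
Lemma ext_lactA a b m : ext_lact (a * b) m = ext_lact a (ext_lact b m).
Proof. by rewrite /ext_lact to_ideal_lM lactA. Qed.
Lemma ext_lact1 m : ext_lact 1 m = m.
Proof. by rewrite /ext_lact to_ideal_l1 lact1. Qed.
Lemma ext_ractDl m n b : ext_ract (m + n) b = ext_ract m b + ext_ract n b.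
Proof. exact: ractDl. Qed.
Lemma ext_ractDr m a b : ext_ract m (a + b) = ext_ract m a + ext_ract m b.
Proof. by rewrite /ext_ract to_ideal_rD ractDr. Qed.
Lemma ext_ractA m a b : ext_ract m (a * b) = ext_ract (ext_ract m a) b.
Proof. by rewrite /ext_ract to_ideal_rM ractA. Qed.
Lemma ext_ract1 m : ext_ract m 1 = m.
Proof. by rewrite /ext_ract to_ideal_r1 ract1. Qed.
Lemma ext_lractA a m b : ext_lact a (ext_ract m b) = ext_ract (ext_lact a m) b.
Proof. exact: lractA. Qed.

Definition ext : bimod A B :=
  Bimod ext_lactDl ext_lactDr ext_lactA ext_lact1
        ext_ractDl ext_ractDr ext_ractA ext_ract1 ext_lractA.
End Extension.

(* gamma_P : Z(J) -> Z(I) for P partially invertible, and its inverse; the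
   defining conditions then determine the values uniquely. The value 0 is
   only taken off the domain. *)
Definition gamma (A B : pzRingType) (P : pbimod A B) (b : B) : A :=
  xget 0 [set a | ideal_center (pb_l P) a /\
                  (ideal_center (pb_r P) b /\ forall p : ext P, a *l p = p *r b)].

Definition gamma_inv (A B : pzRingType) (P : pbimod A B) (a : A) : B :=
  xget 0 [set b | ideal_center (pb_r P) b /\ gamma P b = a].

(* PIC_cat, on representatives: [pic_eq P P'] is equality of the classes of
   P and P', [pic_id A] represents the identity of A, and [pic_comp P P' R]
   says that [P][P'] = [R]: the ideals of R are gamma_P(1_J 1_I')A and
   gamma_P'^{-1}(1_J 1_I')C, and R is isomorphic to P ⊗_B P' over them. *)

Definition pic_eq (A B : pzRingType) (P P' : pbimod A B) : Prop :=
  [/\ pb_l P =i pb_l P', pb_r P =i pb_r P'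
    & isomorphic_over (pb_l P) (pb_r P) (ext P) (ext P')].

Definition pic_id (A : pzRingType) : pbimod A A :=
  @PBimod A A (full_ideal A) (full_ideal A) (regular (ideal_ring (full_ideal A))).

Definition pic_comp (A B C : pzRingType)
    (P : pbimod A B) (P' : pbimod B C) (R : pbimod A C) : Prop :=
  let z := ui_one (pb_r P) * ui_one (pb_l P') in
  [/\ forall a, a \in pb_l R <-> exists x, a = gamma P z * x,
      forall c, c \in pb_r R <-> exists x, c = gamma_inv P' z * x
    & isomorphic_over (pb_l R) (pb_r R) (ext P ⊗ ext P') (ext R)].

Definition pic_comp3 (A B C D : pzRingType)
    (P : pbimod A B) (P' : pbimod B C) (P'' : pbimod C D) (R : pbimod A D) :=
  exists2 S, pic_comp P P' S & pic_comp S P'' R.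

Record groupoid := Groupoid {
  ob :> Type;
  hom : ob -> ob -> Type;
  idm : forall a, hom a a;
  cmp : forall a b c, hom b c -> hom a b -> hom a c;
  inv : forall a b, hom a b -> hom b a;
  cmpA : forall a b c d (g : hom c d) (h : hom b c) (r : hom a b),
    cmp (cmp g h) r = cmp g (cmp h r);
  cmp1m : forall a b (g : hom a b), cmp (idm b) g = g;
  cmpm1 : forall a b (g : hom a b), cmp g (idm a) = g;
  cmpmV : forall a b (g : hom a b), cmp g (inv g) = idm b;
  cmpVm : forall a b (g : hom a b), cmp (inv g) g = idm a
}.

Arguments hom {G} a b : rename.
Arguments idm {G} a : rename.
Arguments cmp {G a b c} g h : rename.
Arguments inv {G a b} g : rename.
Arguments cmpA {G a b c d} g h r : rename.
Notation "g ∘ h" := (cmp g h) (at level 40, left associativity).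

(* A partial functor G -> PIC_cat with chosen representatives [pf_hom]. A morphism
   B -> A of PIC_cat is the class of a partially invertible element of
   [pbimod A B]. [pf_comp] is F(g)F(h) = F(g)F(g^-1)F(gh) = F(gh)F(h^-1)F(h), R
   representing the common value. *)
Record partial_functor (G : groupoid) := PartialFunctor {
  pf_ob : G -> pzRingType;
  pf_hom : forall a b : G, hom a b -> pbimod (pf_ob b) (pf_ob a);
  pf_invertible : forall (a b : G) (g : hom a b), partially_invertible (pf_hom g);
  pf_id : forall a : G, pic_eq (pf_hom (idm a)) (pic_id (pf_ob a));
  pf_comp : forall (a b c : G) (g : hom b c) (h : hom a b),
    exists R : pbimod (pf_ob c) (pf_ob a),
      [/\ pic_comp (pf_hom g) (pf_hom h) R,
          pic_comp3 (pf_hom g) (pf_hom (inv g)) (pf_hom (g ∘ h)) R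
        & pic_comp3 (pf_hom (g ∘ h)) (pf_hom (inv h)) (pf_hom h) R]
}.

Section DirectSum.
Variables (K : Type) (V : K -> zmodType).

Record dsum := DSum {
  ds_fun :> forall k, V k;
  ds_finite : finite_set [set k | ds_fun k != 0]
}.

HB.instance Definition _ := gen_eqMixin dsum.
HB.instance Definition _ := gen_choiceMixin dsum.

Lemma dsumP (s t : dsum) : (forall k, s k = t k) -> s = t.
Proof.
case: s t => s hs [t ht] /= st.
have {}st : s = t by apply: functional_extensionality_dep.
by subst t; congr DSum; apply: Prop_irrelevance.
Qed.

Lemma dsum0_finite : finite_set [set k : K | (0 : V k) != 0].
Proof. by apply: sub_finite_set (finite_set0 _) => k /=; rewrite eqxx. Qed.
Lemma dsumN_finite (s : dsum) : finite_set [set k : K | - s k != 0].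
Proof.
by apply: sub_finite_set (ds_finite s) => k /=; rewrite oppr_eq0.
Qed.
Lemma dsumD_finite (s t : dsum) : finite_set [set k : K | s k + t k != 0].
Proof.
have : finite_set ([set k | s k != 0] `|` [set k | t k != 0]).
  by rewrite finite_setU; split; apply: ds_finite.
apply: sub_finite_set => k /= st0; case: (eqVneq (s k) 0) => s0; last by left.
by right; move: st0; rewrite s0 add0r.
Qed.

Definition dsum0 : dsum := DSum dsum0_finite.
Definition dsumN (s : dsum) : dsum := DSum (dsumN_finite s).
Definition dsumD (s t : dsum) : dsum := DSum (dsumD_finite s t).

Lemma dsumDA : associative dsumD.
Proof. by move=> s t u; apply: dsumP => k /=; rewrite addrA. Qed.
Lemma dsumDC : commutative dsumD.
Proof. by move=> s t; apply: dsumP => k /=; rewrite addrC. Qed.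
Lemma dsum0D : left_id dsum0 dsumD.
Proof. by move=> s; apply: dsumP => k /=; rewrite add0r. Qed.
Lemma dsumND : left_inverse dsum0 dsumN dsumD.
Proof. by move=> s; apply: dsumP => k /=; rewrite addNr. Qed.

HB.instance Definition _ := GRing.isZmodule.Build dsum dsumDA dsumDC dsum0D dsumND.

Definition ds_inj_fun (k : K) (x : V k) : forall l, V l := fun l =>
  match pselect (k = l) with
  | left e => ecast l (V l) e x
  | right _ => 0
  end.

Lemma ds_inj_finite k (x : V k) : finite_set [set l | ds_inj_fun x l != 0].
Proof.
apply: sub_finite_set (finite_set1 k) => l /=; rewrite /ds_inj_fun.
by case: pselect => [e _|]; rewrite ?eqxx.
Qed.

Definition ds_inj k (x : V k) : dsum := DSum (ds_inj_finite x).
End DirectSum.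

Section CrossedProduct.
Variables (G : groupoid) (F : partial_functor G).

Definition Pm (a b : G) (g : hom a b) : bimod (pf_ob F b) (pf_ob F a) :=
  ext (pf_hom F g).

(* epsilon_g, for g with codomain b *)
Definition eps (a b : G) (g : hom a b) : pf_ob F b := ui_one (pb_l (pf_hom F g)).

(* Families f_{g,h} : P_g ⊗ P_h -> P_{gh}; in a partial factor set, f_{g,h} is an
   isomorphism onto the subbimodule epsilon_g P_{gh}. *)
Definition factor_family :=
  forall (a b c : G) (g : hom b c) (h : hom a b), Pm g ⊗ Pm h -> Pm (g ∘ h).

(* The two sides of the associativity condition are compared on pure tensors;
   they lie in P_{(gh)r} and P_{g(hr)}, identified along (gh)r = g(hr). *)
Definition partial_factor_set (f : factor_family) : Prop :=
  (forall (a b c : G) (g : hom b c) (h : hom a b),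
     [/\ bimod_hom (f _ _ _ g h),
         injective (f _ _ _ g h)
       & forall y, (exists t, y = f _ _ _ g h t) <->
                   (exists p : Pm (g ∘ h), y = eps g *l p)]) /\
  (forall (a b c d : G) (g : hom c d) (h : hom b c) (r : hom a b)
          (x : Pm g) (y : Pm h) (z : Pm r),
     ecast k (Pm k) (cmpA g h r)
       (f _ _ _ (g ∘ h) r (f _ _ _ g h (x ⊗t y) ⊗t z))
     = f _ _ _ g (h ∘ r) (x ⊗t f _ _ _ h r (y ⊗t z))).

Record arrow := Arrow { src : G; tgt : G; mor : hom src tgt }.

HB.instance Definition _ := gen_eqMixin arrow.
HB.instance Definition _ := gen_choiceMixin arrow.

Definition Parr (k : arrow) : zmodType := Pm (mor k).

Definition crossed : zmodType := dsum Parr.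

Definition crossed_inj (a b : G) (g : hom a b) (x : Pm g) : crossed :=
  ds_inj (V := Parr) (k := Arrow g) x.

(* x . y for homogeneous x in P_g and y in P_h: it is f_{g,h}(x ⊗ y) when the
   domain b0 of g is the codomain b of h, and 0 otherwise. *)
Definition hom_mul (f : factor_family) (k l : arrow) :
    Parr k -> Parr l -> crossed :=
  match k, l return Parr k -> Parr l -> crossed with
  | Arrow b0 c g, Arrow a b h => fun x y =>
      match pselect (b = b0) with
      | left e =>
          match e in _ = b1 return forall g : hom b1 c, Pm g -> crossed with
          | erefl => fun g x => crossed_inj (f _ _ _ g h (x ⊗t y))
          end g x
      | right _ => 0
      end
  end.

Definition crossed_mul (f : factor_family) (s t : crossed) : crossed :=
  \sum_(k \in [set: arrow]) \sum_(l \in [set: arrow]) hom_mul f (s k) (t l).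

(* For f a partial factor set and finitely many objects, (F,f) has an identity;
   it is not named here, and ring isomorphisms are required to preserve it. *)
Definition mul_identity (f : factor_family) (u : crossed) : Prop :=
  forall s, crossed_mul f u s = s /\ crossed_mul f s u = s.

(* (F,f) ≈ (F,f'): a ring isomorphism (F,f) -> (F,f') restricting for each g to an
   A_{c(g)}-A_{d(g)}-bimodule isomorphism P_g -> P_g. *)
Definition crossed_equiv (f f' : factor_family) : Prop :=
  exists Phi : crossed -> crossed,
    [/\ bijective Phi,
        additive_map Phi,
        forall s t, Phi (crossed_mul f s t) = crossed_mul f' (Phi s) (Phi t),
        forall u, mul_identity f u -> mul_identity f' (Phi u)
      & forall (a b : G) (g : hom a b), exists2 phi : Pm g -> Pm g,
          bimod_iso phi & forall x, Phi (crossed_inj x) = crossed_inj (phi x)].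

Definition crossed_class (f : factor_family) : set factor_family :=
  [set f' | partial_factor_set f' /\ crossed_equiv f f'].

(* C(A,F), a crossed product being represented by its partial factor set *)
Definition CAF : Type :=
  {X : set factor_family |
    exists2 f, partial_factor_set f & X = crossed_class f}.

Definition CAF_class (f : factor_family) (hf : partial_factor_set f) : CAF :=
  exist _ (crossed_class f) (ex_intro2 _ _ f hf erefl).
End CrossedProduct.

Section Ideals.
Variable A : pzRingType.

(* Finite sums of products, the product of ideals of a commutative ring *)
Definition set_mul (X Y : set A) : set A :=
  [set z | exists s : seq (A * A),
     (forall u, u \in s -> X u.1 /\ Y u.2) /\ z = \sum_(u <- s) u.1 * u.2].

Definition is_one (X : set A) (e : A) : Prop :=
  X e /\ forall x, X x -> e * x = x /\ x * e = x.

Definition is_inverse (X : set A) (x y : A) : Prop :=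
  [/\ X y, is_one X (x * y) & is_one X (y * x)].

Definition invertible_in (X : set A) (x : A) : Prop :=
  X x /\ exists y, is_inverse X x y.

(* The inverse of x in X, when x is invertible in X *)
Definition inv_in (X : set A) (x : A) : A := xget 0 (is_inverse X x).
End Ideals.

Section Cohomology.
Variables (G : groupoid) (F : partial_functor G).

(* B_g, as a subset of A_{c(g)} *)
Definition Bg (a b : G) (g : hom a b) : set (pf_ob F b) :=
  ideal_center (pb_l (pf_hom F g)).

Definition B2 (a b c : G) (g : hom b c) (h : hom a b) : set (pf_ob F c) :=
  set_mul (Bg g) (Bg (g ∘ h)).

Definition theta (a b : G) (g : hom a b) : pf_ob F a -> pf_ob F b :=
  gamma (pf_hom F g).

Definition fun1 := forall (a b : G) (g : hom a b), pf_ob F b.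
Definition fun2 := forall (a b c : G) (g : hom b c) (h : hom a b), pf_ob F c.

Definition cochain1 (c : fun1) : Prop :=
  forall (a b : G) (g : hom a b), invertible_in (Bg g) (c _ _ g).

Definition cochain2 (q : fun2) : Prop :=
  forall (a b c : G) (g : hom b c) (h : hom a b),
    invertible_in (B2 g h) (q _ _ _ g h).

Definition delta1 (u : fun1) : fun2 := fun a b c g h =>
  theta g (eps F (inv g) * u _ _ h) * inv_in (Bg (g ∘ h)) (u _ _ (g ∘ h))
  * u _ _ g.

Definition delta2 (q : fun2) (a b c d : G)
    (g : hom c d) (h : hom b c) (r : hom a b) : pf_ob F d :=
  theta g (eps F (inv g) * q _ _ _ h r)
  * (inv_in (B2 (g ∘ h) r) (q _ _ _ (g ∘ h) r) * q _ _ _ g (h ∘ r))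
  * inv_in (B2 g h) (q _ _ _ g h).

Definition cocycle2 (q : fun2) : Prop :=
  cochain2 q /\
  forall (a b c d : G) (g : hom c d) (h : hom b c) (r : hom a b),
    delta2 q g h r = eps F g * eps F (g ∘ h) * eps F (g ∘ h ∘ r).

(* The coset of q modulo the image of delta^1 *)
Definition coset2 (q : fun2) : set fun2 :=
  [set q' | exists2 u, cochain1 u &
     q' = fun a b c g h => q a b c g h * delta1 u g h].

(* H^2(G,B) = ker delta^2 / im delta^1, with elements the cosets *)
Definition H2 : Type :=
  {X : set fun2 | exists2 q, cocycle2 q & X = coset2 q}.

Definition H2_class (q : fun2) (hq : cocycle2 q) : H2 :=
  exist _ (coset2 q) (ex_intro2 _ _ q hq erefl).

Definition twist (q : fun2) (f : factor_family F) : factor_family F :=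
  fun a b c g h t => q _ _ _ g h *l f _ _ _ g h t.
End Cohomology.

(* Main.v *)
From mathcomp Require Import all_boot all_algebra.
From mathcomp Require Import boolp classical_sets functions cardinality fsbigop.
Require Import Defs.

(** The theorem rests on the rigidity of invertible bimodules: if [P] is an
    invertible [I]-[J]-bimodule, then [I] acts faithfully on [P], and every
    bimodule endomorphism of [P] is multiplication by an element of [Z(I)]
    ([invertible_faithful], [invertible_endo]). Any two structures built on the
    same bimodules [P_g] therefore differ by central elements, and identities
    between these elements can be tested by letting them act.

    If [f] and [f'] are two factor sets, then [f_{g,h}] and [f'_{g,h}] are both
    isomorphisms of [P_g ⊗ P_h] with the same bimodule [eps_g P_{gh}]. Hence
    [f' = q f], where [q_{g,h}] is a unit of [B_g B_{gh}]
    ([factor_set_twist]). When a central element [b] is moved from the second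
    factor of [x ⊗ b y] to the left, it becomes [theta_g (eps_{g^-1} b)], so that
    [q f] is associative iff [q_{gh,r} q_{g,h}] and
    [q_{g,hr} theta_g (eps_{g^-1} q_{h,r})] act in the same way on all
    [f (f (x ⊗ y) ⊗ z)]. These elements generate [eps_g eps_{gh} P_{ghr}], which leaves only the equality of the two products:
    the cocycle identity ([twist_factor_set]). Thus [q |-> q f] is a bijection
    from the 2-cocycles to the partial factor sets.

    Likewise a graded isomorphism between crossed products is multiplication by
    a unit [u_g] of [B_g] on each [P_g] ([crossed_equivP]). For [q f] and [q' f]
    its multiplicativity becomes an identity that says that [q] and [q'] differ
    by [delta1 u] ([rescaling_twistP]). So [q f] and [q' f] have the same class
    exactly when [q] and [q'] have the same coset ([eq_coset2]).

    Both arguments need two facts about ideals: the right ideal of [P_g] is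
    [I_{g^-1}], and [theta_g (eps_{g^-1} eps_h) = eps_g eps_{gh}]. They are read
    off from the factor set, by comparing the actions of central idempotents on
    [P_g ⊗ P_h] and on [eps_g P_{gh}] ([right_one_eps], [theta_cut_eps]). *)

Set Implicit Arguments.
Unset Strict Implicit.
Unset Printing Implicit Defensive.

Import GRing.Theory.
Local Open Scope classical_set_scope.
Local Open Scope ring_scope.

(** * Additive maps and tensors *)

Section AdditiveMaps.
Variables (V W : zmodType) (phi : V -> W).
Hypothesis phiD : additive_map phi.

Lemma additive0 : phi 0 = 0.
Proof. by apply: (addIr (phi 0)); rewrite -phiD !add0r. Qed.

Lemma additiveN x : phi (- x) = - phi x.
Proof. by apply: (addIr (phi x)); rewrite -phiD !addNr additive0. Qed.

Lemma additiveB x y : phi (x - y) = phi x - phi y.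
Proof. by rewrite phiD additiveN. Qed.

End AdditiveMaps.

Section BimodBasics.
Variables (R S : pzRingType) (M : bimod R S).

Lemma lactr0 (a : R) : a *l (0 : M) = 0.
Proof. exact: (additive0 (lactDr a)). Qed.

Lemma lactrB (a : R) (x y : M) : a *l (x - y) = a *l x - a *l y.
Proof. exact: (additiveB (lactDr a)). Qed.

Lemma lact0r (x : M) : 0 *l x = 0.
Proof. exact: (additive0 (fun a b => lactDl a b x)). Qed.

Lemma lactBl (a b : R) (x : M) : (a - b) *l x = a *l x - b *l x.
Proof. exact: (additiveB (fun a b => lactDl a b x)). Qed.

Lemma ract0l (b : S) : (0 : M) *r b = 0.
Proof. exact: (additive0 (fun x y => ractDl x y b)). Qed.

Lemma ractr0 (x : M) : x *r 0 = 0.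
Proof. exact: (additive0 (ractDr x)). Qed.

Lemma ractBr (a b : S) (x : M) : x *r (a - b) = x *r a - x *r b.
Proof. exact: (additiveB (ractDr x)). Qed.

End BimodBasics.

Section TensorBasics.
Variables (R S T : pzRingType) (M : bimod R S) (N : bimod S T).

Lemma pure0l (n : N) : pure (0 : M) n = 0.
Proof. exact: (additive0 (fun x y => pureDl x y n)). Qed.

Lemma pure0r (m : M) : pure m (0 : N) = 0.
Proof. exact: (additive0 (pureDr m)). Qed.

Lemma lact_pure a (m : M) (n : N) : a *l (m ⊗t n) = (a *l m) ⊗t n.
Proof. exact: tensor_lact_pure. Qed.

Lemma ract_pure (m : M) (n : N) c : (m ⊗t n) *r c = m ⊗t (n *r c).
Proof. exact: tensor_ract_pure. Qed.

End TensorBasics.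

(** * Central elements and unital ideals *)

Section Central.
Variable A : pzRingType.
Implicit Types x y e : A.

Definition central x := forall a, x * a = a * x.

Lemma centralM x y : central x -> central y -> central (x * y).
Proof. by move=> cx cy a; rewrite -mulrA cy mulrA cx mulrA. Qed.

Lemma central_mulACA x y z w : central z -> x * y * (z * w) = x * z * (y * w).
Proof. by move=> cz; rewrite -!mulrA (mulrA y) -cz !mulrA. Qed.

(** How a relation between units that lie in different ideals is solved for a
    quotient: [a] and [b] are units of the ideals of [e1] and [e2], with inverses
    [a'] and [b'], and [w] lies in the intersection of these ideals. *)
Lemma central_quotient a a' b b' e1 e2 w :
    central a -> central a' -> central b -> central e1 -> central e2 ->
    a * a' = e1 -> b * b' = e2 -> a * e1 = a -> b * e2 = b -> e1 * e2 * w = w ->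
  w * (a' * b') = e1 * e2 <-> a * b = w.
Proof.
move=> ca ca' cb c1 c2 aa bb a1 b2 ew.
have mix : a * b * (a' * b') = e1 * e2.
  by rewrite -mulrA (mulrA b) -ca' -!mulrA bb mulrA aa.
split=> [wE|<- //].
have <- : w * (e1 * e2) = w by rewrite -(centralM c1 c2).
rewrite -mix mulrA -(centralM ca cb) -mulrA wE.
by rewrite -(mulrA a) (mulrA b) -c1 -(mulrA e1) b2 mulrA a1.
Qed.

(** The center of the ideal [e A], when [e] is a central idempotent. *)
Definition corner_center e : set A := [set x | central x /\ e * x = x].

Lemma corner_center_one e : central e -> e * e = e -> corner_center e e.
Proof. by split. Qed.

Lemma corner_centerM e x y :
  corner_center e x -> central y -> corner_center e (x * y).
Proof. by move=> [cx ex] cy; split; [apply: centralM|rewrite mulrA ex]. Qed.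

Variables (e : A) (ce : central e) (ee : e * e = e).

Lemma corner_is_one y : is_one (corner_center e) y <-> y = e.
Proof.
split=> [[[cy ey] hy]|->].
  by have [<- _] := hy e (corner_center_one ce ee); rewrite cy.
split; first exact: corner_center_one.
by move=> x [cx ex]; split=> //; rewrite -ce.
Qed.

(** The corner is commutative, so a one-sided inverse suffices. *)
Lemma corner_is_inverse x y : corner_center e x ->
  is_inverse (corner_center e) x y <-> corner_center e y /\ x * y = e.
Proof.
move=> [cx ex]; split=> [[hy /corner_is_one xy _]|[hy xy]]; first by split.
by split=> //; apply/corner_is_one; rewrite // -cx.
Qed.

Lemma corner_invertible x : invertible_in (corner_center e) x <->
  corner_center e x /\ exists2 y, corner_center e y & x * y = e.
Proof.
split=> [[hx [y /(corner_is_inverse _ hx)[hy xy]]]|[hx [y hy xy]]].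
  by split=> //; exists y.
by split=> //; exists y; apply/corner_is_inverse.
Qed.

Lemma corner_inv_in x : invertible_in (corner_center e) x ->
  corner_center e (inv_in (corner_center e) x) /\
  x * inv_in (corner_center e) x = e.
Proof.
move=> [hx hy]; apply/(corner_is_inverse _ hx).
exact: (xgetPex 0 hy).
Qed.

End Central.

Lemma bimod_hom_scale (R S : pzRingType) (M N : bimod R S) (phi : M -> N) u :
  central u -> bimod_hom phi -> bimod_hom (fun p => u *l phi p).
Proof.
move=> cu [phiD phiL phiR]; split=> [x y|x p|p x].
- by rewrite phiD lactDr.
- by rewrite phiL -!lactA cu.
- by rewrite phiR lractA.
Qed.

Lemma bimod_iso_inv (R S : pzRingType) (M N : bimod R S) (phi : M -> N) psi :
  bimod_hom phi -> cancel phi psi -> cancel psi phi -> bimod_hom psi.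
Proof.
move=> [phiD phiL phiR] phiK psiK; split=> [x y|x p|p x];
  apply: (can_inj phiK).
- by rewrite phiD !psiK.
- by rewrite phiL !psiK.
- by rewrite phiR !psiK.
Qed.

Section UnitalIdeals.
Variables (A : pzRingType) (I : unital_ideal A).

Lemma ui_memP x : x \in I <-> ui_one I * x = x.
Proof.
split=> [|<-]; first exact: ui_mul1.
by apply: ui_memMr; apply: ui_mem1.
Qed.

Lemma ui_one_central : central (ui_one I).
Proof.
move=> a; rewrite -(ui_1mul (ui_memMr a (ui_mem1 I))) -mulrA ui_mul1 //.
by apply: ui_memMl; apply: ui_mem1.
Qed.

Lemma ui_one_idem : ui_one I * ui_one I = ui_one I.
Proof. by rewrite ui_mul1 // ui_mem1. Qed.

(** An element of [Z(I)] commutes with every [a], not only with [I]: the part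
    of [a] outside [I] annihilates [I]. *)
Lemma ideal_centerE : ideal_center I = corner_center (ui_one I).
Proof.
apply/predeqP => x; split=> [[Ix cx]|[cx /ui_memP Ix]].
  split; last exact/ui_memP.
  move=> a; have /ui_memP xE := Ix.
  have x1 : x * ui_one I = x by rewrite ui_1mul.
  rewrite -{1}x1 -mulrA cx; last by apply: ui_memMr; apply: ui_mem1.
  by rewrite ui_one_central -mulrA xE.
by split=> // y _; apply: cx.
Qed.

End UnitalIdeals.

Section Extension.
Variables (A B : pzRingType) (P : pbimod A B).
Local Notation eI := (ui_one (pb_l P)).
Local Notation eJ := (ui_one (pb_r P)).

Lemma ext_lact_ideal (i : ideal_ring (pb_l P)) (p : pb_bimod P) :
  ideal_val i *l (p : ext P) = i *l p.
Proof.
rewrite /= /ext_lact; congr (_ *l p).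
by apply: val_inj; rewrite /= ui_1mul // ideal_valP.
Qed.

Lemma ext_ract_ideal (j : ideal_ring (pb_r P)) (p : pb_bimod P) :
  (p : ext P) *r ideal_val j = p *r j.
Proof.
rewrite /= /ext_ract; congr (p *r _).
by apply: val_inj; rewrite /= ui_mul1 // ideal_valP.
Qed.

Lemma ext_lact_one (p : ext P) : eI *l p = p.
Proof. exact: etrans (ext_lact_ideal 1 p) (@lact1 _ _ (pb_bimod P) p). Qed.

Lemma ext_ract_one (p : ext P) : p *r eJ = p.
Proof. exact: etrans (ext_ract_ideal 1 p) (@ract1 _ _ (pb_bimod P) p). Qed.

End Extension.

(** * Invertible bimodules *)

Section Invertible.
Variables (A B : pzRingType) (P : pbimod A B) (Pinv : partially_invertible P).
Local Notation eI := (ui_one (pb_l P)).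
Local Notation eJ := (ui_one (pb_r P)).

(** The identity of [I] is [alpha] of some tensor, and [a] annihilates the image of
    [alpha] as soon as it annihilates [P]. *)
Lemma invertible_ann a : (forall p : ext P, a *l p = 0) -> eI * a = 0.
Proof.
case: Pinv => Q [alpha [beta ed]] aP0.
have [[alphaD alphaL _] [alphaV alphaVK alphaK]] := ed_alpha ed.
have ann t : a * ideal_val (alpha t : ideal_ring (pb_l P)) = 0.
  elim/tensor_ind: t => [p q||x y hx hy].
  - have -> : a * ideal_val (alpha (p ⊗t q) : ideal_ring (pb_l P)) =
      ideal_val (alpha (to_ideal_l (pb_l P) a *l (p ⊗t q)) : ideal_ring (pb_l P)).
      by rewrite alphaL /= -mulrA ui_mul1 // ideal_valP.
    by rewrite lact_pure (aP0 p : _ *l p = 0) pure0l (additive0 alphaD).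
  - by rewrite (additive0 alphaD) /= mulr0.
  - by rewrite (additiveB alphaD) /= mulrBr hx hy subr0.
by rewrite ui_one_central -(ann (alphaV 1)) alphaK.
Qed.

Lemma invertible_faithful a b : eI * a = a -> eI * b = b ->
  (forall p : ext P, a *l p = b *l p) -> a = b.
Proof.
move=> Ia Ib ab; apply/eqP; rewrite -subr_eq0 -Ia -Ib -mulrBr.
by apply/eqP/invertible_ann => p; rewrite lactBl ab subrr.
Qed.

Lemma invertible_rann b : (forall p : ext P, p *r b = 0) -> eJ * b = 0.
Proof.
case: Pinv => Q [alpha [beta ed]] Pb0.
have [[betaD _ betaR] [betaV betaVK betaK]] := ed_beta ed.
have ann t : ideal_val (beta t : ideal_ring (pb_r P)) * b = 0.
  elim/tensor_ind: t => [q p||x y hx hy].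
  - have -> : ideal_val (beta (q ⊗t p) : ideal_ring (pb_r P)) * b =
      ideal_val (beta ((q ⊗t p) *r to_ideal_r (pb_r P) b) : ideal_ring (pb_r P)).
      by rewrite betaR /= mulrA ui_1mul // ideal_valP.
    by rewrite ract_pure (Pb0 p : p *r _ = 0) pure0r (additive0 betaD).
  - by rewrite (additive0 betaD) /= mul0r.
  - by rewrite (additiveB betaD) /= mulrBl hx hy subr0.
by rewrite -(ann (betaV 1)) betaK.
Qed.

(** With [1 = sum of alpha (p_i ⊗ q_i)], one has
    [phi p = sum of phi (p_i beta (q_i ⊗ p)) = (sum of alpha (phi p_i ⊗ q_i)) p].
    Centrality of the multiplier follows from faithfulness. *)
Lemma invertible_endo (phi : ext P -> ext P) : bimod_hom phi ->
  exists2 u, corner_center eI u & forall p, phi p = u *l p.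
Proof.
move=> [phiD phiL phiR].
suff [u Iu phiE] : exists2 u, u \in pb_l P & forall p, phi p = u *l p.
  have /ui_memP eu := Iu; exists u => //; rewrite -ideal_centerE; split=> // y Iy.
  have /ui_memP ey := Iy.
  apply: invertible_faithful => [||p]; rewrite ?mulrA ?eu ?ey //.
  by rewrite !lactA -!phiE phiL.
case: Pinv => Q [alpha [beta ed]].
have [[alphaD _ _] [alphaV _ alphaK]] := ed_alpha ed.
(* The multiplier for [t] with [alpha t = 1] is wanted; the statement for all [t]
   allows an induction on tensors. *)
have scale t : exists2 u, u \in pb_l P & forall p,
    phi (ideal_val (alpha t : ideal_ring (pb_l P)) *l p) = u *l p.
  elim/tensor_ind: t => [p0 q||x y [u Iu hu] [v Iv hv]].
  - exists (ideal_val (alpha ((phi p0 : pb_bimod P) ⊗t q) : ideal_ring (pb_l P))).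
      exact: ideal_valP.
    move=> p; rewrite !ext_lact_ideal !(ed_PQP ed).
    by rewrite -ext_ract_ideal phiR ext_ract_ideal.
  - exists 0; first exact: ui_mem0.
    by move=> p; rewrite (additive0 alphaD) !lact0r (additive0 phiD).
  - exists (u - v); first exact: ui_memB.
    by move=> p; rewrite (additiveB alphaD) !lactBl (additiveB phiD) hu hv.
have [u Iu hu] := scale (alphaV 1); exists u => // p.
by rewrite -hu alphaK ext_lact_one.
Qed.

(** The value [gamma P b] exists because right multiplication by the central
    element [b] is an endomorphism of [P]. *)
Lemma gammaP b : corner_center eJ b ->
  corner_center eI (gamma P b) /\ forall p : ext P, gamma P b *l p = p *r b.
Proof.
move=> Jb; have [cb _] := Jb.
have [|u Iu hu] := @invertible_endo (fun p => p *r b).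
  split=> [x y|a m|m c]; first exact: ractDl.
    by rewrite lractA.
  by rewrite -!ractA cb.
have : exists a, [set a | ideal_center (pb_l P) a /\
    (ideal_center (pb_r P) b /\ forall p : ext P, a *l p = p *r b)] a.
  by exists u; split; rewrite ideal_centerE; [|split=> // p; rewrite hu].
by case/(xgetPex 0); rewrite -/(gamma P b) ideal_centerE => ? [].
Qed.

End Invertible.

(** Tensoring with the inverse [Q] of [P] sends [x ⊗ y ⊗ q] to
    [x alpha (y ⊗ q)], and the elements [alpha (y ⊗ q)] generate [I]. *)
Lemma tensor_invertible_ann (A B C : pzRingType) (M : bimod A B) (P : pbimod B C) :
    partially_invertible P ->
  forall x : M, (forall y : ext P, x ⊗t y = 0) -> x *r ui_one (pb_l P) = 0.
Proof.
move=> [Q [alpha [beta ed]]] x x0.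
have [[alphaD alphaL _] [alphaV _ alphaK]] := ed_alpha ed.
pose I := ideal_ring (pb_l P).
have xA t : x *r ideal_val (alpha t : I) = 0.
  elim/tensor_ind: t => [y q||s t hs ht].
  - pose b (m : M) (n : ext P) := m *r ideal_val (alpha ((n : pb_bimod P) ⊗t q) : I).
    have bDl m m' n : b (m + m') n = b m n + b m' n by exact: ractDl.
    have bDr m n n' : b m (n + n') = b m n + b m n'.
      by rewrite /b pureDl alphaD ractDr.
    have bB m s n : b (m *r s) n = b m (s *l n).
      rewrite /b -ractA; congr (_ *r _).
      rewrite [s *l n]/(ext_lact s n) /ext_lact -lact_pure alphaL /=.
      by rewrite -mulrA ui_mul1 // ideal_valP.
    rewrite -[LHS]/(b x y) -(tensor_lift_pure bDl bDr bB) x0.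
    exact: tensor_lift0 bDl bDr bB.
  - by rewrite (additive0 alphaD) ractr0.
  - by rewrite (additiveB alphaD) ractBr hs ht subr0.
by have := xA (alphaV 1); rewrite alphaK.
Qed.

(** * Finitely supported sums *)

Lemma fsum_single (T : choiceType) (V : zmodType) (k0 : T) (s : T -> V) :
  (forall k, k != k0 -> s k = 0) -> \sum_(k \in [set: T]) s k = s k0.
Proof.
move=> s0; transitivity (\sum_(k \in [set k0]) s k); last exact: fsbig_set1.
apply/esym/fsbig_widen => // k [_ /= /eqP kk0]; exact: s0.
Qed.

Lemma additive_fsum (T : choiceType) (V W : zmodType) (phi : V -> W) (s : T -> V) :
    additive_map phi -> finite_set [set k | s k != 0] ->
  phi (\sum_(k \in [set: T]) s k) = \sum_(k \in [set: T]) phi (s k).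
Proof.
move=> phiD s_fin.
rewrite -(@fsbig_widen _ _ _ _ [set k | s k != 0]) //; last first.
  by move=> k [_ /= /negP/negPn/eqP].
rewrite -[RHS](@fsbig_widen _ _ _ _ [set k | s k != 0]) //; last first.
  by move=> k [_ /= /negP/negPn/eqP ->]; rewrite (additive0 phiD).
rewrite !fsbig_finite //; apply: (big_morph phi) => //.
exact: additive0.
Qed.

Lemma ds_inj_eq (K : Type) (V : K -> zmodType) (k : K) (x : V k) :
  ds_inj x k = x.
Proof.
rewrite /= /ds_inj_fun; case: pselect => // e.
by rewrite (Prop_irrelevance e erefl).
Qed.

Lemma ds_inj_neq (K : Type) (V : K -> zmodType) (k l : K) (x : V k) :
  l <> k -> ds_inj x l = 0.
Proof. by move=> lk; rewrite /= /ds_inj_fun; case: pselect => // kl; case: lk. Qed.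

(** * Partial factor sets *)

Section FactorSets.
Variables (G : groupoid) (F : partial_functor G).

Lemma eps_central a b (g : hom a b) : central (eps F g).
Proof. exact: ui_one_central. Qed.

Lemma eps_idem a b (g : hom a b) : eps F g * eps F g = eps F g.
Proof. exact: ui_one_idem. Qed.

Lemma Pm_eps a b (g : hom a b) (p : Pm F g) : eps F g *l p = p.
Proof. exact: ext_lact_one. Qed.

Lemma Pm_faithful a b (g : hom a b) x y : eps F g * x = x -> eps F g * y = y ->
  (forall p : Pm F g, x *l p = y *l p) -> x = y.
Proof. exact: (invertible_faithful (pf_invertible F g)). Qed.

Definition eps2 a b c (g : hom b c) (h : hom a b) : pf_ob F c :=
  eps F g * eps F (g ∘ h).

Lemma eps2_central a b c (g : hom b c) (h : hom a b) : central (eps2 g h).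
Proof. by apply: centralM; apply: eps_central. Qed.

Lemma eps2_l a b c (g : hom b c) (h : hom a b) : eps F g * eps2 g h = eps2 g h.
Proof. by rewrite mulrA eps_idem. Qed.

Lemma eps2_r a b c (g : hom b c) (h : hom a b) :
  eps F (g ∘ h) * eps2 g h = eps2 g h.
Proof. by rewrite eps_central -mulrA eps_idem. Qed.

Lemma eps2_idem a b c (g : hom b c) (h : hom a b) :
  eps2 g h * eps2 g h = eps2 g h.
Proof. by rewrite {1}/eps2 -mulrA eps2_r eps2_l. Qed.

Lemma BgE a b (g : hom a b) : Bg (F := F) g = corner_center (eps F g).
Proof. exact: ideal_centerE. Qed.

(** Both factors are ideals of the center of [A_{c(g)}], generated by the
    idempotents [eps g] and [eps (g ∘ h)], so their product is generated by the
    product of these. *)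
Lemma B2E a b c (g : hom b c) (h : hom a b) :
  B2 (F := F) g h = corner_center (eps2 g h).
Proof.
rewrite /B2 !BgE; apply/predeqP => x; split=> [[s [hs ->]]|[cx ex]].
  have {}hs u : u \in s -> corner_center (eps2 g h) (u.1 * u.2).
    move=> /hs [[c1 e1] [c2 e2]]; split; first exact: centralM.
    by rewrite /eps2 -mulrA (mulrA (eps F (g ∘ h))) -c1 -(mulrA u.1) e2 mulrA e1.
  elim: s hs => [|u s IHs] hs.
    by rewrite big_nil; split; [move=> y; rewrite mul0r mulr0 | rewrite mulr0].
  rewrite big_cons; have [cu eu] := hs u (mem_head u s).
  have [|cs es] := IHs; first by move=> v vs; apply: hs; rewrite inE vs orbT.
  by split=> [y|]; rewrite ?mulrDl mulrDr ?cu ?cs // eu es.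
exists [:: (eps F g, eps F (g ∘ h) * x)]; split; last first.
  by rewrite big_seq1 /= mulrA -[eps F g * _]/(eps2 g h) ex.
move=> u; rewrite inE => /eqP -> /=.
split; first exact: corner_center_one (eps_central g) (eps_idem g).
by apply: corner_centerM => //; apply: corner_center_one;
  [apply: eps_central | apply: eps_idem].
Qed.

(** The generator corresponds to [1] in the regular bimodule. *)
Lemma Pm_idm_generator a : exists p0 : Pm F (idm a),
  (forall x y, x *l p0 = y *l p0 -> x = y) /\ (forall x, x *l p0 = p0 *r x).
Proof.
have [hl hr [phi [phiD phiL phiR [psi phiK psiK]]]] := pf_id F a.
pose one : ext (pic_id (pf_ob F a)) := (1 : ideal_ring (full_ideal _)).
have vl x (i : ext (pic_id (pf_ob F a))) : ideal_val (x *l i : ideal_ring _) =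
    x * ideal_val (i : ideal_ring _) by rewrite /= mulr1.
have vr x (i : ext (pic_id (pf_ob F a))) : ideal_val (i *r x : ideal_ring _) =
    ideal_val (i : ideal_ring _) * x by rewrite /= mul1r.
exists (psi one); split=> [x y /(congr1 phi)|x].
  rewrite !phiL ?hl // psiK => /(congr1 (@ideal_val _ _)).
  by rewrite !vl /= !mulr1.
apply: (can_inj phiK); rewrite phiL ?hl // phiR ?hr // psiK.
by apply: val_inj; rewrite [LHS]vl [RHS]vr /= mulr1 mul1r.
Qed.

(** A form for [g ∘ inv g], which equals an identity only propositionally. *)
Lemma Pm_loop_generator a (k : hom a a) : k = idm a -> exists p0 : Pm F k,
  (forall x y, x *l p0 = y *l p0 -> x = y) /\ (forall x, x *l p0 = p0 *r x).
Proof. by move=> ->; apply: Pm_idm_generator. Qed.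

Section OneFactorSet.
Variables (f : factor_family F) (f_pfs : partial_factor_set f).

Section Pair.
Variables (a b c : G) (g : hom b c) (h : hom a b).
Local Notation fgh := (f (g:=g) (h:=h)).

Lemma factorD : additive_map fgh.
Proof. by have [[hD _ _] _ _] := f_pfs.1 _ _ _ g h; exact: hD. Qed.

Lemma factorL x t : fgh (x *l t) = x *l fgh t.
Proof. by have [[_ hL _] _ _] := f_pfs.1 _ _ _ g h; exact: hL. Qed.

Lemma factorR x t : fgh (t *r x) = fgh t *r x.
Proof. by have [[_ _ hR] _ _] := f_pfs.1 _ _ _ g h; exact: hR. Qed.

Lemma factor_inj : injective fgh.
Proof. by have [_ + _] := f_pfs.1 _ _ _ g h. Qed.

Lemma factor_surj (p : Pm F (g ∘ h)) : exists t, eps F g *l p = fgh t.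
Proof. by have [_ _ im] := f_pfs.1 _ _ _ g h; apply/im; exists p. Qed.

Lemma eps_factor t : eps F g *l fgh t = fgh t.
Proof.
have [_ _ im] := f_pfs.1 _ _ _ g h.
have [|p ->] := (im (fgh t)).1; first by exists t.
by rewrite -lactA eps_idem.
Qed.

Lemma eps2_factor t : eps2 g h *l fgh t = fgh t.
Proof. by rewrite lactA Pm_eps eps_factor. Qed.

Lemma factor_ext x y :
    (forall p q, x *l fgh (p ⊗t q) = y *l fgh (p ⊗t q)) ->
  forall t, x *l fgh t = y *l fgh t.
Proof.
move=> xy; elim/tensor_ind => [//||s t hs ht].
  by rewrite (additive0 factorD) !lactr0.
by rewrite (additiveB factorD) !lactrB hs ht.
Qed.

(** The image of [f_{g,h}] is all of [eps_g P_{gh}], and [P_{gh}] is faithful. *)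
Lemma factor_faithful x y : eps2 g h * x = x -> eps2 g h * y = y ->
  (forall p q, x *l fgh (p ⊗t q) = y *l fgh (p ⊗t q)) -> x = y.
Proof.
move=> ex ey /factor_ext xy.
have gx : x * eps F g = x by rewrite -eps_central -ex mulrA eps2_l.
have gy : y * eps F g = y by rewrite -eps_central -ey mulrA eps2_l.
apply: (@Pm_faithful _ _ (g ∘ h)); first by rewrite -ex mulrA eps2_r.
  by rewrite -ey mulrA eps2_r.
move=> p; have [t pt] := factor_surj p.
by rewrite -gx -gy !lactA pt.
Qed.

End Pair.

(** Write [J] for the identity of the right ideal of [P_g] and [E] for
    [eps (inv g)]. Moving [E] across the tensor shows that [gamma (J E)] acts as
    the identity on [P_g ⊗ P_{g^-1}]; this bimodule is isomorphic to [eps_g A],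
    hence [gamma (J E) = eps_g] and [J E = J]. Moreover [J] acts from the right as
    the identity on [P_{g^-1} ⊗ P_g], which is isomorphic to [E A], hence
    [E J = E]. *)
Lemma right_one_eps a b (g : hom a b) :
  ui_one (pb_r (pf_hom F g)) = eps F (inv g).
Proof.
set J := ui_one _; set E := eps F (inv g).
have cJ : central J by exact: ui_one_central.
have JJ : J * J = J by exact: ui_one_idem.
have cE : central E by exact: eps_central.
have gJ (p : Pm F g) : p *r J = p by exact: ext_ract_one.
have JE : J * E = J.
  have hJE : corner_center J (J * E).
    by apply: corner_centerM => //; apply: corner_center_one.
  have [[ce ee] eP] := gammaP (pf_invertible F g) hJE.
  set e := gamma _ _ in ce ee eP.
  have {}eP (p : Pm F g) : e *l p = p *r E.
    by rewrite -[p in RHS]gJ -ractA; apply: eP.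
  have [p0 [p0_free _]] := Pm_loop_generator (cmpmV g).
  have [t pt] := factor_surj (g := g) (h := inv g) p0.
  have e1 : e = eps F g.
    rewrite -ee eps_central; apply: p0_free; rewrite lactA pt.
    rewrite -[RHS]lact1; apply: factor_ext => p q; rewrite lact1.
    by rewrite -factorL lact_pure eP pure_bal Pm_eps.
  apply/eqP; rewrite eq_sym -subr_eq0 -{1}JJ -mulrBr; apply/eqP.
  apply: (invertible_rann (pf_invertible F g)) => p.
  by rewrite ractBr [_ *r J]gJ -[_ *r E]eP e1 [_ *l p]Pm_eps subrr.
rewrite -JE cJ.
have [p0 [p0_free p0_comm]] := Pm_loop_generator (cmpVm g).
have [t pt] := factor_surj (g := inv g) (h := g) p0.
apply: p0_free; rewrite lactA p0_comm lractA pt -factorR; congr (f _).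
elim/tensor_ind: t {pt} => [p q||s t hs ht].
- by rewrite ract_pure gJ.
- exact: ract0l.
- by rewrite [LHS](additiveB (fun x y => ractDl x y J)) hs ht.
Qed.

(** The form in which [theta] occurs in the coboundaries: [x] is first cut down
    to the domain of [theta]. *)
Definition theta_cut a b (g : hom a b) (x : pf_ob F a) : pf_ob F b :=
  theta g (eps F (inv g) * x).

Lemma theta_cutP a b (g : hom a b) x : central x ->
  corner_center (eps F g) (theta_cut g x) /\
  forall p : Pm F g, theta_cut g x *l p = p *r x.
Proof.
move=> cx; have [|h1 h2] := gammaP (pf_invertible F g) (b := eps F (inv g) * x).
  rewrite right_one_eps; apply: corner_centerM => //.
  by apply: corner_center_one; [apply: eps_central | apply: eps_idem].
split=> // p; rewrite [LHS]h2 ractA; congr (_ *r x).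
by rewrite -right_one_eps; apply: ext_ract_one.
Qed.

Lemma pure_theta_cut a b c (g : hom b c) (h : hom a b) x (p : Pm F g) (q : Pm F h) :
  central x -> p ⊗t (x *l q) = theta_cut g x *l (p ⊗t q).
Proof. by move=> /(theta_cutP g)[_ hx]; rewrite lact_pure hx pure_bal. Qed.

Lemma theta_cutM a b (g : hom a b) x y : central x -> central y ->
  theta_cut g (x * y) = theta_cut g x * theta_cut g y.
Proof.
move=> cx cy; have [[cx' ex] hx] := theta_cutP g cx.
have [[cy' ey] hy] := theta_cutP g cy.
have [[_ exy] hxy] := theta_cutP g (centralM cx cy).
apply: (@Pm_faithful _ _ g) => // [|p]; first by rewrite mulrA ex.
by rewrite hxy cx' lactA hx hy ractA.
Qed.

(** Both sides act as the identity on [P_g ⊗ P_h]. For [theta_cut g (eps h)]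
    this is balancing, so it is transported to [eps_g P_{gh}]. For
    [eps_g eps_{gh}] it gives [(eps_g eps_{gh} x - x) ⊗ y = 0] for all [y], and
    tensoring away [P_h] shows that [eps_g eps_{gh}] acts as the identity on
    [P_g eps_h], where [theta_cut g (eps h)] maps [P_g]. *)
Lemma theta_cut_eps a b c (g : hom b c) (h : hom a b) :
  theta_cut g (eps F h) = eps2 g h.
Proof.
have [[ce ee] eP] := theta_cutP g (eps_central h).
set e := theta_cut _ _ in ce ee eP *.
transitivity (eps2 g h * e).
  apply: (@Pm_faithful _ _ g) => // [|p]; first by rewrite mulrA eps2_l.
  rewrite lactA eP lractA; apply/eqP.
  rewrite -subr_eq0 -(additiveB (fun x y => ractDl x y (eps F h))); apply/eqP.
  apply: (tensor_invertible_ann (pf_invertible F h)) => q.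
  apply: (@factor_inj _ _ _ g h).
  rewrite (additiveB (fun x y => pureDl x y q)) (additiveB (@factorD _ _ _ g h)).
  rewrite -[pure (_ *l p) q]lact_pure factorL eps2_factor subrr.
  by rewrite (additive0 (@factorD _ _ _ g h)).
apply: (@factor_faithful _ _ _ g h) => [||p q]; [|exact: eps2_idem|].
  by rewrite [LHS]mulrA eps2_idem.
by rewrite lactA -factorL lact_pure eP pure_bal Pm_eps.
Qed.

End OneFactorSet.

(** * Cochains *)

Lemma cochain1P (u : fun1 F) : cochain1 u <-> forall a b (g : hom a b),
  corner_center (eps F g) (u _ _ g) /\
  exists2 v, corner_center (eps F g) v & u _ _ g * v = eps F g.
Proof.
split=> hu a b g; have := hu a b g; rewrite BgE => hg;
  exact/(corner_invertible (eps_central g) (eps_idem g)).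
Qed.

Lemma cochain1_inv (u : fun1 F) a b (g : hom a b) : cochain1 u ->
  corner_center (eps F g) (inv_in (Bg g) (u _ _ g)) /\
  u _ _ g * inv_in (Bg g) (u _ _ g) = eps F g.
Proof.
by move=> /(_ _ _ g); rewrite BgE;
  exact: corner_inv_in (eps_central g) (eps_idem g) _.
Qed.

Lemma cochain2P (q : fun2 F) : cochain2 q <->
  forall a b c (g : hom b c) (h : hom a b),
  corner_center (eps2 g h) (q _ _ _ g h) /\
  exists2 q', corner_center (eps2 g h) q' & q _ _ _ g h * q' = eps2 g h.
Proof.
split=> hq a b c g h; have := hq a b c g h; rewrite B2E => hgh;
  exact/(corner_invertible (eps2_central g h) (eps2_idem g h)).
Qed.

Lemma cochain2_inv (q : fun2 F) a b c (g : hom b c) (h : hom a b) : cochain2 q ->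
  corner_center (eps2 g h) (inv_in (B2 g h) (q _ _ _ g h)) /\
  q _ _ _ g h * inv_in (B2 g h) (q _ _ _ g h) = eps2 g h.
Proof.
by move=> /(_ _ _ _ g h); rewrite B2E;
  exact: corner_inv_in (eps2_central g h) (eps2_idem g h) _.
Qed.

Lemma ecast_lact a b (k k' : hom a b) (e : k = k') x (p : Pm F k) :
  ecast k (Pm F k) e (x *l p) = x *l ecast k (Pm F k) e p.
Proof. by case: _ / e. Qed.

Lemma ecast_inj a b (k k' : hom a b) (e : k = k') :
  injective (fun p : Pm F k => ecast k (Pm F k) e p).
Proof. by case: _ / e => p p'. Qed.

(** * Factor sets compared with a given one *)

Section Ratio.
Variables (f f' : factor_family F).
Variables (f_pfs : partial_factor_set f) (f'_pfs : partial_factor_set f').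
Variables (a b c : G) (g : hom b c) (h : hom a b).
Local Notation fgh := (f (g:=g) (h:=h)).
Local Notation fgh' := (f' (g:=g) (h:=h)).

(** [f' f^-1] is an endomorphism of [eps_g P_{gh}]; composed with the projection
    [p |-> eps_g p] it extends to [P_{gh}], which is invertible. *)
Lemma factor_ratio :
  exists2 q, corner_center (eps2 g h) q & forall t, fgh' t = q *l fgh t.
Proof.
(* [s p] is the preimage of [eps_g p] under [f], unique by injectivity. *)
pose pre p := cid (factor_surj f_pfs (g := g) (h := h) p).
pose s p := projT1 (pre p); have sP p : eps F g *l p = fgh (s p) := projT2 (pre p).
have s_f t : s (fgh t) = t.
  by apply: (factor_inj f_pfs); rewrite -sP (eps_factor f_pfs).
have s_hom : bimod_hom s.
  split=> [x y|x p|p x]; apply: (factor_inj f_pfs).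
  - by rewrite (factorD f_pfs) -!sP lactDr.
  - by rewrite (factorL f_pfs) -!sP -!lactA eps_central.
  - by rewrite (factorR f_pfs) -!sP lractA.
have [sD sL sR] := s_hom.
have [|u [cu eu] uP] :=
    invertible_endo (pf_invertible F (g ∘ h)) (phi := fun p => fgh' (s p)).
  split=> [x y|x p|p x]; first by rewrite sD (factorD f'_pfs).
    by rewrite sL (factorL f'_pfs).
  by rewrite sR (factorR f'_pfs).
exists (eps F g * u).
  split; first by apply: centralM => //; apply: eps_central.
  by rewrite mulrA -eps_central eps2_l /eps2 -mulrA eu.
move=> t; rewrite lactA -[u *l _]uP s_f.
by rewrite (eps_factor f'_pfs).
Qed.

End Ratio.

Section Twists.
Variables (f : factor_family F) (f_pfs : partial_factor_set f).

Lemma factor_set_twist f' : partial_factor_set f' ->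
  exists2 q : fun2 F, cochain2 q & f' = twist q f.
Proof.
move=> f'_pfs.
pose ratio a b c (g : hom b c) (h : hom a b) :=
  cid2 (factor_ratio f_pfs f'_pfs g h).
pose q : fun2 F := fun a b c g h => s2val (ratio a b c g h).
have qP a b c (g : hom b c) (h : hom a b) :
  corner_center (eps2 g h) (q _ _ _ g h) := s2valP (ratio a b c g h).
have qE a b c (g : hom b c) (h : hom a b) t :
  @f' _ _ _ g h t = q _ _ _ g h *l @f _ _ _ g h t := s2valP' (ratio a b c g h) t.
exists q.
  apply/cochain2P => a b c g h; split; first exact: qP.
  have [q' cq' q'E] := factor_ratio f'_pfs f_pfs g h; exists q' => //.
  apply: (factor_faithful f'_pfs) => [||x y]; [|exact: eps2_idem|].
    by rewrite [LHS]mulrA; have [_ ->] := qP _ _ _ g h.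
  by rewrite lactA -q'E -qE (eps2_factor f'_pfs).
do 5!apply: functional_extensionality_dep => ?.
by apply: functional_extensionality_dep => t; rewrite qE.
Qed.

Lemma twist_hom q a b c (g : hom b c) (h : hom a b) : cochain2 q ->
  bimod_hom (twist q f (g := g) (h := h)).
Proof.
move=> /cochain2P /(_ _ _ _ g h) [[cq _] _].
by apply: bimod_hom_scale => //; have [] := f_pfs.1 _ _ _ g h.
Qed.

Lemma twist_inj q a b c (g : hom b c) (h : hom a b) : cochain2 q ->
  injective (twist q f (g := g) (h := h)).
Proof.
move=> /cochain2P /(_ _ _ _ g h) [[cq _] [q' [cq' _] qq']] s t.
move=> /(congr1 (lact q')); rewrite /twist -!lactA -cq qq'.
by rewrite !(eps2_factor f_pfs); apply: (factor_inj f_pfs).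
Qed.

Lemma twist_image q a b c (g : hom b c) (h : hom a b) y : cochain2 q ->
  (exists t, y = twist q f (g := g) (h := h) t) <->
  (exists p : Pm F (g ∘ h), y = eps F g *l p).
Proof.
move=> /cochain2P /(_ _ _ _ g h) [[cq eq] [q' [cq' _] qq']].
split=> [[t ->]|[p ->]].
  exists (q _ _ _ g h *l @f _ _ _ g h t).
  by rewrite -lactA eps_central lactA (eps_factor f_pfs).
have [t pt] := factor_surj f_pfs (g := g) (h := h) p.
exists (q' *l t); rewrite /twist (factorL f_pfs) -lactA qq' -pt.
by rewrite -lactA -eps_central eps2_l /eps2 lactA Pm_eps.
Qed.

Definition eps3 a b c d (g : hom c d) (h : hom b c) (r : hom a b) : pf_ob F d :=
  eps F g * eps F (g ∘ h) * eps F (g ∘ h ∘ r).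

(** The elements [f (f (p ⊗ q) ⊗ z)] generate [eps_g eps_{gh} P_{ghr}], because
    the image of [f_{g,h}] is [eps_g P_{gh}] and that of [f_{gh,r}] is
    [eps_{gh} P_{ghr}]. *)
Lemma factor_faithful3 a b c d (g : hom c d) (h : hom b c) (r : hom a b) x y :
    eps3 g h r * x = x -> eps3 g h r * y = y ->
    (forall p q z, x *l @f _ _ _ (g ∘ h) r (@f _ _ _ g h (p ⊗t q) ⊗t z) =
                   y *l @f _ _ _ (g ∘ h) r (@f _ _ _ g h (p ⊗t q) ⊗t z)) ->
  x = y.
Proof.
move=> ex ey xy.
have gE : eps F g * eps3 g h r = eps3 g h r by rewrite /eps3 !mulrA eps_idem.
have ghE : eps2 (g ∘ h) r * eps3 g h r = eps3 g h r.
  rewrite /eps3 -mulrA -[X in _ * (_ * X)]/(eps2 _ r).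
  by rewrite mulrA -eps_central -mulrA eps2_idem.
have gx : x * eps F g = x by rewrite -eps_central -ex mulrA gE.
have gy : y * eps F g = y by rewrite -eps_central -ey mulrA gE.
apply: (factor_faithful f_pfs (g := g ∘ h) (h := r)) => [||p z].
- by rewrite -ex mulrA ghE.
- by rewrite -ey mulrA ghE.
(* Only the multiples [eps_g p] are values of [f_{g,h}]; the factor [eps_g] comes
   from [x] and [y]. *)
have slide w : (w * eps F g) *l f (p ⊗t z) = w *l f ((eps F g *l p) ⊗t z).
  by rewrite lactA -(factorL f_pfs) lact_pure.
rewrite -gx -gy !slide; have [t ->] := factor_surj f_pfs (g := g) (h := h) p.
elim/tensor_ind: t => [p' q'||s t hs ht]; first exact: xy.
  by rewrite (additive0 (@factorD _ f_pfs _ _ _ g h)) pure0l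
    (additive0 (@factorD _ f_pfs _ _ _ (g ∘ h) r)) !lactr0.
rewrite (additiveB (@factorD _ f_pfs _ _ _ g h)) (additiveB (fun x y => pureDl x y z)).
by rewrite (additiveB (@factorD _ f_pfs _ _ _ (g ∘ h) r)) !lactrB hs ht.
Qed.

Lemma eps3_cocycle_rhs q a b c d (g : hom c d) (h : hom b c) (r : hom a b) :
    cochain2 q ->
  eps3 g h r * (q _ _ _ g (h ∘ r) * theta_cut g (q _ _ _ h r)) =
  q _ _ _ g (h ∘ r) * theta_cut g (q _ _ _ h r).
Proof.
move=> /cochain2P hq.
have [[_ ed] _] := hq _ _ _ g (h ∘ r); have [[cv ev] _] := hq _ _ _ h r.
have tE : eps F (g ∘ h) * theta_cut g (q _ _ _ h r) = theta_cut g (q _ _ _ h r).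
  rewrite -ev (theta_cutM f_pfs) //; last exact: eps2_central.
  rewrite (theta_cutM f_pfs) ?(theta_cut_eps f_pfs) //; try exact: eps_central.
  by rewrite -(mulrA (eps2 g h)) [LHS]mulrA eps2_r.
have -> : eps3 g h r = eps F (g ∘ h) * eps2 g (h ∘ r).
  by rewrite /eps3 /eps2 cmpA mulrA (eps_central (g ∘ h)).
by rewrite -mulrA (mulrA (eps2 _ _)) ed mulrA eps_central -mulrA tE.
Qed.

(** The inverses in [delta2] are taken in different ideals; the cocycle identity
    is equivalent to its form without inverses because [theta_cut_eps] places both
    sides in the common ideal of [eps_g], [eps_{gh}] and [eps_{ghr}]. *)
Lemma cocycle2P q : cochain2 q -> cocycle2 q <->
  forall a b c d (g : hom c d) (h : hom b c) (r : hom a b),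
  q _ _ _ (g ∘ h) r * q _ _ _ g h =
  q _ _ _ g (h ∘ r) * theta_cut g (q _ _ _ h r).
Proof.
move=> q_cochain; have /cochain2P hq := q_cochain.
have quot a b c d (g : hom c d) (h : hom b c) (r : hom a b) :
    delta2 q g h r = eps F g * eps F (g ∘ h) * eps F (g ∘ h ∘ r) <->
    q _ _ _ (g ∘ h) r * q _ _ _ g h =
    q _ _ _ g (h ∘ r) * theta_cut g (q _ _ _ h r).
  have [[ca ea] _] := hq _ _ _ (g ∘ h) r; have [[cb eb] _] := hq _ _ _ g h.
  have [[cd _] _] := hq _ _ _ g (h ∘ r).
  have [[ca' _] aa'] := cochain2_inv (g ∘ h) r q_cochain.
  have [_ bb'] := cochain2_inv g h q_cochain.
  have e3E : eps2 (g ∘ h) r * eps2 g h = eps3 g h r.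
    by rewrite eps2_central /eps2 -mulrA (mulrA (eps F (g ∘ h))) eps_idem mulrA.
  rewrite -[_ * eps F (g ∘ h ∘ r)]/(eps3 g h r) -e3E.
  have -> : delta2 q g h r = q _ _ _ g (h ∘ r) * theta_cut g (q _ _ _ h r) *
      (inv_in (B2 (g ∘ h) r) (q _ _ _ (g ∘ h) r) * inv_in (B2 g h) (q _ _ _ g h)).
    by rewrite /delta2 -/(theta_cut g _) ca' mulrA -cd -!mulrA.
  apply: central_quotient => //; try exact: eps2_central.
  - by rewrite -eps2_central.
  - by rewrite -eps2_central.
  - by rewrite e3E; apply: eps3_cocycle_rhs.
by split=> [[_ qc] *|qc]; [apply/quot | split=> // *; apply/quot].
Qed.

(** Both sides of the associativity of [q f] are central multiples of the same
    element [f (f (x ⊗ y) ⊗ z)], by the associativity of [f]. *)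
Lemma twist_assoc q a b c d (g : hom c d) (h : hom b c) (r : hom a b) :
    cochain2 q ->
  (forall x y z, ecast k (Pm F k) (cmpA g h r)
      (twist q f (g := g ∘ h) (h := r) (twist q f (x ⊗t y) ⊗t z))
    = twist q f (x ⊗t twist q f (y ⊗t z))) <->
  q _ _ _ (g ∘ h) r * q _ _ _ g h =
    q _ _ _ g (h ∘ r) * theta_cut g (q _ _ _ h r).
Proof.
move=> q_cochain; have /cochain2P hq := q_cochain.
have [[ca ea] _] := hq _ _ _ (g ∘ h) r.
have [[cb eb] _] := hq _ _ _ g h.
have [[cd ed] _] := hq _ _ _ g (h ∘ r).
have [[cv ev] _] := hq _ _ _ h r.
have [[ct et] tP] := theta_cutP f_pfs g cv.
have lhs x y z : ecast k (Pm F k) (cmpA g h r)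
    (twist q f (g := g ∘ h) (h := r) (twist q f (x ⊗t y) ⊗t z)) =
  (q _ _ _ (g ∘ h) r * q _ _ _ g h) *l f (x ⊗t f (y ⊗t z)).
  rewrite -(f_pfs.2 _ _ _ _ g h r) -ecast_lact; congr (ecast _ _ _ _).
  rewrite /twist -[pure (_ *l _) z]lact_pure lactA; congr (_ *l _).
  exact: (factorL f_pfs).
have rhs (x : Pm F g) (y : Pm F h) (z : Pm F r) : twist q f (x ⊗t twist q f (y ⊗t z)) =
  (q _ _ _ g (h ∘ r) * theta_cut g (q _ _ _ h r)) *l f (x ⊗t f (y ⊗t z)).
  by rewrite /twist (pure_theta_cut f_pfs _ _ cv) (factorL f_pfs) lactA.
split=> [assoc|E x y z]; last by rewrite lhs rhs E.
have bE : eps F g * q _ _ _ g h = q _ _ _ g h by rewrite -eb mulrA eps2_l.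
have e3_ab : eps3 g h r * (q _ _ _ (g ∘ h) r * q _ _ _ g h) =
    q _ _ _ (g ∘ h) r * q _ _ _ g h.
  have -> : eps3 g h r = eps F g * eps2 (g ∘ h) r by rewrite /eps3 -mulrA.
  by rewrite -mulrA (mulrA (eps2 _ _)) ea mulrA eps_central -mulrA bE.
have e3_dt := eps3_cocycle_rhs g h r q_cochain.
apply: (factor_faithful3 (g := g) (h := h) (r := r)) => // x y z.
apply: (ecast_inj (e := cmpA g h r)).
by rewrite !ecast_lact f_pfs.2 -lhs -rhs assoc.
Qed.

Lemma twist_factor_set q : cochain2 q ->
  partial_factor_set (twist q f) <-> cocycle2 q.
Proof.
move=> q_cochain; rewrite cocycle2P //; split=> [[_ assoc] *|qc].
  by apply/twist_assoc => // x y z; apply: assoc.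
split=> [a b c g h|a b c d g h r]; last by apply/twist_assoc.
split; [exact: twist_hom | exact: twist_inj | move=> y; exact: twist_image].
Qed.

End Twists.

(** * Graded isomorphisms of crossed products *)

Section Homogeneous.
Variable f : factor_family F.
Hypothesis f_hom : forall a b c (g : hom b c) (h : hom a b),
  bimod_hom (f (g := g) (h := h)).

Lemma hom_mul0l (k l : arrow G) (y : Parr F l) : hom_mul f (0 : Parr F k) y = 0.
Proof.
case: k l y => b0 c g [a b h] y /=; case: pselect => // e.
case: b0 / e g => g; have [fD _ _] := f_hom g h.
rewrite pure0l (additive0 fD).
by apply: dsumP => k; rewrite /= /ds_inj_fun; case: pselect => // e; case: _ / e.
Qed.

Lemma hom_mul0r (k l : arrow G) (x : Parr F k) : hom_mul f x (0 : Parr F l) = 0.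
Proof.
case: k l x => b0 c g [a b h] x /=; case: pselect => // e.
case: b0 / e g x => g x; have [fD _ _] := f_hom g h.
rewrite pure0r (additive0 fD).
by apply: dsumP => k; rewrite /= /ds_inj_fun; case: pselect => // e; case: _ / e.
Qed.

Lemma hom_mul_comp a b c (g : hom b c) (h : hom a b) (x : Pm F g) (y : Pm F h) :
  hom_mul f (k := Arrow g) (l := Arrow h) x y = crossed_inj (f (x ⊗t y)).
Proof.
rewrite /=; case: pselect => // e.
by rewrite (Prop_irrelevance e erefl).
Qed.

Lemma crossed_mul_inj a b c (g : hom b c) (h : hom a b) (x : Pm F g) (y : Pm F h) :
  crossed_mul f (crossed_inj x) (crossed_inj y) = crossed_inj (f (x ⊗t y)).
Proof.
rewrite /crossed_mul (fsum_single (k0 := Arrow g)) => [|k /eqP kg]; last first.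
  rewrite fsbig1 // => l _.
  by rewrite [crossed_inj x k](ds_inj_neq (V := Parr F) (k := Arrow g) x kg) hom_mul0l.
rewrite (fsum_single (k0 := Arrow h)) => [|l /eqP lh]; last first.
  by rewrite [crossed_inj y l](ds_inj_neq (V := Parr F) (k := Arrow h) y lh) hom_mul0r.
by rewrite ![crossed_inj _ _]ds_inj_eq hom_mul_comp.
Qed.

End Homogeneous.

Lemma crossed_equiv_refl (f : factor_family F) : crossed_equiv f f.
Proof.
exists id; split=> //; first by exists id.
by move=> a b g; exists id => //; split=> //; exists id.
Qed.

Lemma crossed_equiv_trans (f1 f2 f3 : factor_family F) :
  crossed_equiv f1 f2 -> crossed_equiv f2 f3 -> crossed_equiv f1 f3.
Proof.
move=> [Phi [Phi_bij PhiD PhiM Phi1 PhiP]] [Psi [Psi_bij PsiD PsiM Psi1 PsiP]].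
exists (Psi \o Phi); split.
- exact: bij_comp.
- by move=> x y /=; rewrite PhiD PsiD.
- by move=> x y /=; rewrite PhiM PsiM.
- by move=> u /Phi1 /Psi1.
move=> a b g; have [phi [[phiD phiL phiR] phi_bij] phiE] := PhiP _ _ g.
have [psi [[psiD psiL psiR] psi_bij] psiE] := PsiP _ _ g.
exists (psi \o phi); last by move=> x /=; rewrite phiE psiE.
split; last exact: bij_comp.
by split=> [x y|x p|p x] /=; rewrite ?phiD ?psiD ?phiL ?psiL ?phiR ?psiR.
Qed.

(** The inverse maps identities to identities because a bijective multiplicative
    map transports the defining property. *)
Lemma crossed_equiv_sym (f1 f2 : factor_family F) :
  crossed_equiv f1 f2 -> crossed_equiv f2 f1.
Proof.
move=> [Phi [[Psi PhiK PsiK] PhiD PhiM Phi1 PhiP]].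
have PsiM s t : Psi (crossed_mul f2 s t) = crossed_mul f1 (Psi s) (Psi t).
  by apply: (can_inj PhiK); rewrite PhiM !PsiK.
exists Psi; split=> //.
- by exists Phi.
- by move=> x y; apply: (can_inj PhiK); rewrite PhiD !PsiK.
- move=> u u1 s; rewrite -[s]PhiK -!PsiM.
  by have [-> ->] := u1 (Phi s).
move=> a b g; have [phi [phi_hom [psi phiK psiK]] phiE] := PhiP _ _ g.
exists psi; last by move=> x; apply: (can_inj PhiK); rewrite PsiK phiE psiK.
by split; [apply: bimod_iso_inv phi_hom phiK psiK | exists phi].
Qed.

Lemma Pm_iso_unit a b (g : hom a b) (phi : Pm F g -> Pm F g) : bimod_iso phi ->
  exists2 u, corner_center (eps F g) u /\
    (exists2 v, corner_center (eps F g) v & u * v = eps F g) &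
  forall p, phi p = u *l p.
Proof.
move=> [phi_hom [psi phiK psiK]].
have psi_hom := bimod_iso_inv phi_hom phiK psiK.
have [u uc uE] := invertible_endo (pf_invertible F g) phi_hom.
have [v vc vE] := invertible_endo (pf_invertible F g) psi_hom.
exists u => //; split=> //; exists v => //.
apply: (@Pm_faithful _ _ g) => [||p].
- by rewrite mulrA; have [_ ->] := uc.
- exact: eps_idem.
by rewrite lactA -[v *l p]vE -[u *l _]uE psiK Pm_eps.
Qed.

Section Scaling.
Variable u : fun1 F.

Definition scale_at (s : crossed F) (k : arrow G) : Parr F k :=
  (u (mor k) *l (s k : Pm F (mor k))).

Lemma scale_finite s : finite_set [set k | scale_at s k != 0].
Proof.
apply: sub_finite_set (ds_finite s) => k /=; apply: contra_neq => sk.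
by rewrite /scale_at sk lactr0.
Qed.

Definition crossed_scale (s : crossed F) : crossed F := DSum (scale_finite s).

Lemma crossed_scaleD : additive_map crossed_scale.
Proof. by move=> s t; apply: dsumP => k; apply: lactDr. Qed.

Lemma crossed_scale_inj a b (g : hom a b) (x : Pm F g) :
  crossed_scale (crossed_inj x) = crossed_inj (u g *l x).
Proof.
apply: dsumP => k; case: (pselect (k = Arrow g)) => [->|kg].
  by rewrite [RHS]ds_inj_eq /= /scale_at [crossed_inj x _]ds_inj_eq.
rewrite [RHS](ds_inj_neq (V := Parr F) (k := Arrow g) _ kg) /= /scale_at.
by rewrite [crossed_inj x _](ds_inj_neq (V := Parr F) (k := Arrow g) _ kg) lactr0.
Qed.

End Scaling.

Section Equivalence.
Variables f1 f2 : factor_family F.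
Hypothesis f1_hom : forall a b c (g : hom b c) (h : hom a b),
  bimod_hom (f1 (g := g) (h := h)).
Hypothesis f2_hom : forall a b c (g : hom b c) (h : hom a b),
  bimod_hom (f2 (g := g) (h := h)).

(** Multiplicativity on homogeneous elements of the map that multiplies each
    component [P_g] by [u_g]. *)
Definition rescaling (u : fun1 F) :=
  forall a b c (g : hom b c) (h : hom a b) (x : Pm F g) (y : Pm F h),
  u _ _ (g ∘ h) *l f1 (x ⊗t y) = f2 ((u _ _ g *l x) ⊗t (u _ _ h *l y)).

Lemma crossed_scale_mul u : rescaling u -> forall s t,
  crossed_scale u (crossed_mul f1 s t) =
  crossed_mul f2 (crossed_scale u s) (crossed_scale u t).
Proof.
move=> u_res s t.
have scale_hom_mul (k l : arrow G) (x : Parr F k) (y : Parr F l) :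
    crossed_scale u (hom_mul f1 x y) =
    hom_mul f2 (u _ _ (mor k) *l (x : Pm F (mor k)) : Parr F k)
               (u _ _ (mor l) *l (y : Pm F (mor l)) : Parr F l).
  case: k l x y => b0 c g [a b h] x y.
  case: (pselect (b = b0)) => [e|nb].
    case: b0 / e g x => g x.
    by rewrite !hom_mul_comp crossed_scale_inj u_res.
  rewrite /=; case: pselect => // _; exact: additive0 (crossed_scaleD u).
rewrite /crossed_mul (additive_fsum (crossed_scaleD u)); last first.
  apply: sub_finite_set (ds_finite s) => k /=; apply: contra_neq => sk.
  by rewrite fsbig1 // => l _; rewrite sk hom_mul0l.
apply: eq_fsbigr => k _; rewrite (additive_fsum (crossed_scaleD u)); last first.
  apply: sub_finite_set (ds_finite t) => l /=; apply: contra_neq => tl.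
  by rewrite tl hom_mul0r.
by apply: eq_fsbigr => l _; apply: scale_hom_mul.
Qed.

(** A graded isomorphism is multiplication by a unit on each invertible [P_g];
    conversely the product is determined by homogeneous elements. *)
Lemma crossed_equivP :
  crossed_equiv f1 f2 <-> exists2 u, cochain1 u & rescaling u.
Proof.
split=> [[Phi [_ PhiD PhiM _ PhiP]]|[u u_cochain u_res]].
  have unit a b (g : hom a b) : { u |
      corner_center (eps F g) u /\
        (exists2 v, corner_center (eps F g) v & u * v = eps F g)
    & forall p : Pm F g, Phi (crossed_inj p) = crossed_inj (u *l p)}.
    apply: cid2; have [phi phi_iso phiE] := PhiP _ _ g.
    have [u uc uE] := Pm_iso_unit phi_iso.
    by exists u => // p; rewrite phiE uE.
  pose u : fun1 F := fun a b g => s2val (unit a b g).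
  exists u; first by apply/cochain1P => a b g; exact: s2valP (unit a b g).
  have uE a b (g : hom a b) (p : Pm F g) :
    Phi (crossed_inj p) = crossed_inj (u _ _ g *l p) := s2valP' (unit a b g) p.
  move=> a b c g h x y.
  have := PhiM (crossed_inj x) (crossed_inj y).
  rewrite !uE !crossed_mul_inj // uE.
  move=> /(congr1 (fun s : crossed F => s (Arrow (g ∘ h)))).
  by rewrite ![crossed_inj _ _]ds_inj_eq.
have u_inv a b (g : hom a b) := cochain1_inv g u_cochain.
pose v : fun1 F := fun a b g => inv_in (Bg g) (u _ _ g).
have scaleK s : crossed_scale u (crossed_scale v s) = s.
  apply: dsumP => k; rewrite /= /scale_at -lactA.
  by rewrite (u_inv _ _ (mor k)).2 [LHS]Pm_eps.
have scaleVK s : crossed_scale v (crossed_scale u s) = s.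
  apply: dsumP => k; rewrite /= /scale_at -lactA.
  by rewrite (u_inv _ _ (mor k)).1.1 (u_inv _ _ (mor k)).2 [LHS]Pm_eps.
have scaleM := crossed_scale_mul u_res.
exists (crossed_scale u); split.
- by exists (crossed_scale v).
- exact: crossed_scaleD.
- exact: scaleM.
- move=> e e1 s; rewrite -[s]scaleK -!scaleM.
  by have [-> ->] := e1 (crossed_scale v s).
move=> a b g; have /cochain1P/(_ _ _ g)[[cu eu] _] := u_cochain.
exists (lact (u _ _ g)); last by move=> x; rewrite crossed_scale_inj.
split; last first.
  exists (lact (v _ _ g)) => p; rewrite -lactA.
    by rewrite (u_inv _ _ g).1.1 (u_inv _ _ g).2 Pm_eps.
  by rewrite (u_inv _ _ g).2 Pm_eps.
by apply: (bimod_hom_scale (phi := id)).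
Qed.

End Equivalence.

(** * Cohomologous cocycles *)

Section Cosets.
Variables (f : factor_family F) (f_pfs : partial_factor_set f).

Lemma delta1E (u : fun1 F) a b c (g : hom b c) (h : hom a b) : cochain1 u ->
  delta1 u g h =
    inv_in (Bg (g ∘ h)) (u _ _ (g ∘ h)) * (u _ _ g * theta_cut g (u _ _ h)).
Proof.
move=> u_cochain; have [[ci _] _] := cochain1_inv (g ∘ h) u_cochain.
have [[ch _] _] := (cochain1P u).1 u_cochain _ _ h.
have [[ct _] _] := theta_cutP f_pfs g ch.
by rewrite /delta1 -/(theta_cut g _) -mulrA ct mulrA.
Qed.

(** [delta1 u g h] has the factor [theta_cut g (u h)], which is a unit only in
    the smaller ideal of [theta_cut g (eps h)]; by [theta_cut_eps] this is the ideal
    of [eps2 g h] in which 2-cochains take their values. *)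
Lemma delta1_unit (u : fun1 F) a b c (g : hom b c) (h : hom a b) :
  cochain1 u -> central (delta1 u g h) /\
  exists2 w, central w & delta1 u g h * w = eps2 g h.
Proof.
move=> u_cochain; have [[ci _] ui] := cochain1_inv (g ∘ h) u_cochain.
have hu := (cochain1P u).1 u_cochain.
have [[cgh _] _] := hu _ _ (g ∘ h).
have [[cg _] [v [cv _] uv]] := hu _ _ g.
have [[ch _] [w [cw _] uw]] := hu _ _ h.
have [[ct _] _] := theta_cutP f_pfs g ch.
have [[ct' _] _] := theta_cutP f_pfs g cw.
rewrite delta1E //; split; first by do !apply: centralM.
exists (u _ _ (g ∘ h) * (v * theta_cut g w)); first by do !apply: centralM.
rewrite central_mulACA // -[_ * u _ _ (g ∘ h)]cgh ui central_mulACA // uv.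
by rewrite -(theta_cutM f_pfs) // uw (theta_cut_eps f_pfs) eps2_l eps2_r.
Qed.

Lemma cochain2_delta1 q u : cochain2 q -> cochain1 u ->
  @cochain2 G F (fun a b c g h => q a b c g h * delta1 u g h).
Proof.
move=> /cochain2P q_cochain u_cochain; apply/cochain2P => a b c g h.
have [qc [q' q'c qq']] := q_cochain _ _ _ g h.
have [dc [w wc dw]] := delta1_unit g h u_cochain.
split; first exact: corner_centerM.
exists (q' * w); first exact: corner_centerM.
by rewrite central_mulACA ?qq' ?dw ?eps2_idem //; case: q'c.
Qed.

(** By faithfulness the rescaling says that
    [u_{gh} p_{g,h} = q_{g,h} u_g theta_cut g (u_h)]; division by [u_{gh}] turns
    this into [p = q delta1 u]. *)
Lemma rescaling_twistP p q u : cochain2 p -> cochain2 q -> cochain1 u ->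
  rescaling (twist p f) (twist q f) u <->
  p = fun a b c g h => q a b c g h * delta1 u g h.
Proof.
move=> /cochain2P p_cochain /cochain2P q_cochain u_cochain.
have hu := (cochain1P u).1 u_cochain.
suff res a b c (g : hom b c) (h : hom a b) :
    (forall (x : Pm F g) (y : Pm F h), u _ _ (g ∘ h) *l twist p f (x ⊗t y) =
       twist q f ((u _ _ g *l x) ⊗t (u _ _ h *l y))) <->
    p _ _ _ g h = q _ _ _ g h * delta1 u g h.
  split=> [u_res|pE a b c g h]; last by apply/res; rewrite pE.
  do 5!apply: functional_extensionality_dep => ?.
  by apply/res => x y; apply: u_res.
have [[cp ep] _] := p_cochain _ _ _ g h; have [[cq eq] _] := q_cochain _ _ _ g h.
have [[cgh _] _] := hu _ _ (g ∘ h); have [[cg _] _] := hu _ _ g.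
have [[ch _] _] := hu _ _ h; have [[ct _] _] := theta_cutP f_pfs g ch.
have [[ci _] ui] := cochain1_inv (g ∘ h) u_cochain.
have ghp : eps F (g ∘ h) * p _ _ _ g h = p _ _ _ g h.
  by rewrite -ep mulrA eps2_r.
have ghq : eps F (g ∘ h) * q _ _ _ g h = q _ _ _ g h.
  by rewrite -eq mulrA eps2_r.
have lhs (x : Pm F g) (y : Pm F h) : u _ _ (g ∘ h) *l twist p f (x ⊗t y) =
    (u _ _ (g ∘ h) * p _ _ _ g h) *l f (x ⊗t y) by rewrite lactA.
have rhs (x : Pm F g) (y : Pm F h) :
    twist q f ((u _ _ g *l x) ⊗t (u _ _ h *l y)) =
    (q _ _ _ g h * (u _ _ g * theta_cut g (u _ _ h))) *l f (x ⊗t y).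
  rewrite /twist (pure_theta_cut f_pfs _ _ ch) -lact_pure -lactA (factorL f_pfs).
  by rewrite ct -lactA.
rewrite delta1E //; set w := u _ _ g * _ in rhs *.
transitivity (u _ _ (g ∘ h) * p _ _ _ g h = q _ _ _ g h * w).
  split=> [u_res|E x y]; last by rewrite lhs rhs E.
  apply: (factor_faithful f_pfs (g := g) (h := h)) => [||x y].
  - by rewrite mulrA -cgh -mulrA ep.
  - by rewrite mulrA eq.
  - by rewrite -lhs -rhs.
split=> [E|->].
  by rewrite -ghp -ui cgh -mulrA E mulrA ci -mulrA.
by rewrite mulrA cgh -mulrA (mulrA (u _ _ (g ∘ h))) ui mulrA -eps_central ghq.
Qed.

(** By [rescaling_twistP] the factor [u] rescales [q' f] into [q f], in this
    direction; the symmetry of the equivalence turns it round. The cosets are thus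
    the classes of an equivalence relation, which is how they are compared. *)
Lemma coset2P q q' : cochain2 q -> coset2 q q' <->
  cochain2 q' /\ crossed_equiv (twist q f) (twist q' f).
Proof.
move=> q_cochain.
have q_hom a b c (g : hom b c) (h : hom a b) := twist_hom f_pfs g h q_cochain.
split=> [[u u_cochain q'E]|[q'_cochain /crossed_equiv_sym]].
  have q'_cochain : cochain2 q' by rewrite q'E; apply: cochain2_delta1.
  split=> //; apply: crossed_equiv_sym.
  apply/crossed_equivP => // [a b c g h|]; first exact: twist_hom.
  by exists u => //; apply/rescaling_twistP.
have q'_hom a b c (g : hom b c) (h : hom a b) := twist_hom f_pfs g h q'_cochain.
move=> /(crossed_equivP q'_hom q_hom) [u u_cochain u_res].
by exists u => //; apply/rescaling_twistP.
Qed.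

Lemma eq_coset2 q q' : cochain2 q -> cochain2 q' ->
  coset2 q = coset2 q' <-> crossed_equiv (twist q f) (twist q' f).
Proof.
move=> q_cochain q'_cochain; split=> [qq'|qq'].
  have : coset2 q q'.
    by rewrite qq'; apply/coset2P => //; split=> //; apply: crossed_equiv_refl.
  by case/coset2P.
apply/predeqP => p; split=> /coset2P [] // p_cochain pE; apply/coset2P => //.
  by split=> //; apply: crossed_equiv_trans pE; apply: crossed_equiv_sym.
by split=> //; apply: crossed_equiv_trans qq' pE.
Qed.

End Cosets.

Lemma eq_crossed_class (f1 f2 : factor_family F) : partial_factor_set f2 ->
  crossed_class f1 = crossed_class f2 <-> crossed_equiv f1 f2.
Proof.
move=> f2_pfs; split=> [f12|f12].
  have : crossed_class f2 f2 by split=> //; apply: crossed_equiv_refl.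
  by rewrite -f12 => -[].
apply/predeqP => f; split=> -[f_pfs fE]; split=> //.
  by apply: crossed_equiv_trans fE; apply: crossed_equiv_sym.
exact: crossed_equiv_trans f12 fE.
Qed.

End FactorSets.

(** * The bijection *)

Theorem theorem3 (G : groupoid) (F : partial_functor G) (f : factor_family F)
    (G0_finite : finite_set [set: ob G]) (f_pfs : partial_factor_set f) :
  exists Theta : H2 F -> CAF F,
    (forall (q : fun2 F) (hq : cocycle2 q),
       exists hqf : partial_factor_set (twist q f),
         Theta (H2_class hq) = CAF_class hqf) /\
    bijective Theta.
Proof.
have twist_pfs q : cocycle2 q -> partial_factor_set (twist q f).
  by move=> hq; apply/(twist_factor_set f_pfs hq.1).
have classE q q' (hq : cocycle2 q) (hq' : cocycle2 q') :
    coset2 q = coset2 q' <->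
    crossed_class (twist q f) = crossed_class (twist q' f).
  rewrite (eq_coset2 f_pfs hq.1 hq'.1).
  by split=> /(eq_crossed_class _ (twist_pfs _ hq')).
pose rep (X : H2 F) := cid2 (proj2_sig X).
pose Theta (X : H2 F) : CAF F := CAF_class (twist_pfs _ (s2valP (rep X))).
have repE X : proj1_sig X = coset2 (s2val (rep X)) := s2valP' (rep X).
have ThetaE q (hq : cocycle2 q) :
    Theta (H2_class hq) = CAF_class (twist_pfs q hq).
  by apply: eq_exist; apply/(classE _ _ (s2valP (rep _)) hq); rewrite -repE.
exists Theta; split=> [q hq|]; first by exists (twist_pfs q hq).
have Theta_inj : injective Theta.
  move=> X Y /(congr1 (@proj1_sig _ _)) /= XY.
  have : proj1_sig X = proj1_sig Y.
    apply: etrans (repE X) (etrans _ (esym (repE Y))).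
    exact: (classE _ _ (s2valP (rep X)) (s2valP (rep Y))).2 XY.
  by case: X Y {XY} => [X hX] [Y hY] /= XY; apply: eq_exist.
have Theta_surj (Y : CAF F) : exists X, Theta X = Y.
  case: Y => Y [f' f'_pfs YE].
  have [q q_cochain f'E] := factor_set_twist f_pfs f'_pfs.
  have hq : cocycle2 q by apply/(twist_factor_set f_pfs q_cochain); rewrite -f'E.
  by exists (H2_class hq); rewrite ThetaE; apply: eq_exist; rewrite YE f'E.
pose inv Y := projT1 (cid (Theta_surj Y)).
have invK Y : Theta (inv Y) = Y := projT2 (cid (Theta_surj Y)).
by exists inv => // X; apply: Theta_inj; rewrite invK.
Qed.
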